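(* The affine space $\mathfrak A$ is definable in terms of the point-line structure $\mathfrak B_1$ and, consequently, the projective space $\mathfrak P$ is definable in terms of $\mathfrak B_1$ as well.
   Context: Setting. $\mathfrak F$ is a perfect field of characteristic $2$, $\mathbb V$ is a vector space over $\mathfrak F$ of finite dimension $n\ge 2$, and $\mathfrak P$ is the projective space of $\mathbb V$ (points are $\langle u\rangle$ with $u\in\mathbb V$ nonzero). Lines of $\mathfrak P$ have at least $6$ points. $\xi$ is a nondegenerate symmetric bilinear form on $\mathbb V$ which is not alternating, and $\langle u\rangle\perp\langle v\rangle$ means $\xi(u,v)=0$. The set $\mathbf H$ of selfconjugate points ($p\perp p$) is then a hyperplane of $\mathfrak P$ ($\perp$ is a pseudo-polarity), and its pole is a point $\mathbf b$ (so $\mathbf b^\perp=\mathbf H$); $\mathbf b$ may or may not lie on $\mathbf H$. For a subspace $U$ of $\mathfrak P$, $\dim(U)$ is the vector dimension (points have dimension $1$, lines $2$, planes $3$), $U^\perp=\{p: p\perp q\text{ for all }q\in U\}$, $\mathrm{Rad}(U)=U\cap U^\perp$, and $U$ is regular if $\mathrm{Rad}(U)=\emptyset$. $\mathscr R_k$ is the set of regular $k$-dimensional subspaces. Thus $\mathscr R_1$ is the set of points not on $\mathbf H$. Structures. $\mathfrak A=\langle\mathscr R_1,\mathcal L\rangle$ is the affine space obtained from $\mathfrak P$ by deleting $\mathbf H$; its lines are identified with the lines of $\mathfrak P$ not contained in $\mathbf H$. $\mathfrak B_1$ is the point-line structure with points the regular points different from $\mathbf b$, lines the regular lines not contained in $\mathbf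 H$, and natural incidence. Definability. Let $M,N$ be structures whose elements are points or subspaces of $\mathfrak P$. $N$ is definable in terms of $M$ if it can be described using only the primitive notions of $M$: the elements of $N$ can be represented by tuples of elements of $M$ ranging over sets given by parameter-free first-order formulas in the language of $M$, modulo equivalence relations given by such formulas, in such a way that all the primitive relations of $N$, and the natural inclusion relations between elements of $N$ and elements of $M$ (as subspaces of $\mathfrak P$), are given by such formulas as well. *)

(* Defs.v *)
From HB Require Import structures.
From mathcomp Require Import all_boot all_order all_algebra.

Set Implicit Arguments.
Unset Strict Implicit.
Unset Printing Implicit Defensive.

Import GRing.Theory.
Local Open Scope ring_scope.

Record language := Language { symbol : Type; arity : symbol -> nat }.

(* [formula L X] is the type of first-order formulas (with equality, without
   parameters) over [L] whose free variables belong to [X].  A quantifier binds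
   the extra variable [None] of [option X]. *)
Inductive formula (L : language) (X : Type) : Type :=
| FEq (x y : X)
| FRel (s : symbol L) (v : 'I_(arity s) -> X)
| FNot (phi : formula L X)
| FAnd (phi psi : formula L X)
| FOr (phi psi : formula L X)
| FImp (phi psi : formula L X)
| FAll (phi : formula L (option X))
| FEx (phi : formula L (option X)).

Arguments FEq {L X} x y.
Arguments FRel {L X} s v.

Record structure (T : Type) (L : language) := Structure {
  dom : T -> Prop;
  rel : forall s : symbol L, ('I_(arity s) -> T) -> Prop }.

Arguments dom {T L} _ _.
Arguments rel {T L} _ s _.

Definition extend (T X : Type) (u : T) (e : X -> T) (x : option X) : T :=
  if x is Some y then e y else u.

Definition join (T X Y : Type) (e : X -> T) (e' : Y -> T) (x : X + Y) : T :=
  match x with inl y => e y | inr y => e' y end.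

Fixpoint sat (T : Type) (L : language) (M : structure T L)
    (X : Type) (phi : formula L X) : (X -> T) -> Prop :=
  match phi with
  | FEq x y => fun e => e x = e y
  | FRel s v => fun e => rel M s (fun i => e (v i))
  | FNot p => fun e => ~ sat M p e
  | FAnd p q => fun e => sat M p e /\ sat M q e
  | FOr p q => fun e => sat M p e \/ sat M q e
  | FImp p q => fun e => sat M p e -> sat M q e
  | FAll p => fun e => forall u, dom M u -> sat M p (extend u e)
  | FEx p => fun e => exists2 u, dom M u & sat M p (extend u e)
  end.

Section Definability.

Variables (F : fieldType) (V : vectType F).

(* A tuple [a] of elements of [M] lying in the set defined by [delta]. *)
Definition in_def (L : language) (M : structure {vspace V} L) (k : nat)
    (delta : formula L 'I_k) (a : 'I_k -> {vspace V}) : Prop :=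
  (forall i, dom M (a i)) /\ sat M delta a.

(* The elements of [N] are represented by tuples of elements of [M] of finitely
   many kinds [t]: a tuple of length [k t] satisfying [delta t] represents
   [f t a]; outside these tuples the values of [f t] are irrelevant. *)
Definition definable_in (LN LM : language)
    (N : structure {vspace V} LN) (M : structure {vspace V} LM) : Prop :=
  exists (K : finType) (k : K -> nat) (delta : forall t, formula LM 'I_(k t))
         (f : forall t, ('I_(k t) -> {vspace V}) -> {vspace V}),
  [/\ (forall t a, in_def M (delta t) a -> dom N (f t a)) /\
      (forall u, dom N u -> exists t a, in_def M (delta t) a /\ f t a = u),
      forall t t', exists phi : formula LM ('I_(k t) + 'I_(k t')),
        forall a b, in_def M (delta t) a -> in_def M (delta t') b ->
          (sat M phi (join a b) <-> f t a = f t' b),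
      forall (s : symbol LN) (t : 'I_(arity s) -> K),
        exists phi : formula LM {i : 'I_(arity s) & 'I_(k (t i))},
        forall a : (forall i, 'I_(k (t i)) -> {vspace V}),
          (forall i, in_def M (delta (t i)) (a i)) ->
          (sat M phi (fun x => a (tag x) (tagged x)) <->
           rel N s (fun i => f (t i) (a i))),
      forall t, exists phi : formula LM (option 'I_(k t)),
        forall a u, in_def M (delta t) a -> dom M u ->
          (sat M phi (extend u a) <-> (f t a <= u)%VS)
    & forall t, exists phi : formula LM (option 'I_(k t)),
        forall a u, in_def M (delta t) a -> dom M u ->
          (sat M phi (extend u a) <-> (u <= f t a)%VS)].

End Definability.

Inductive pl_symbol := IsPoint | IsLine | Incident.

Definition pl_language : language :=
  Language (fun s => match s with IsPoint | IsLine => 1%N | Incident => 2%N end).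

Section PointLine.

Variables (F : fieldType) (V : vectType F).

Definition pl_structure (P L : {vspace V} -> Prop) :
    structure {vspace V} pl_language :=
  @Structure _ pl_language (fun u => P u \/ L u)
    (fun s => match s return
                ('I_(@arity pl_language s) -> {vspace V}) -> Prop with
     | IsPoint => fun a => P (a ord0)
     | IsLine => fun a => L (a ord0)
     | Incident => fun a =>
         [/\ P (a ord0), L (a ord_max) & (a ord0 <= a ord_max)%VS]
     end).

Definition is_point (p : {vspace V}) : Prop := \dim p = 1%N.
Definition is_line (l : {vspace V}) : Prop := \dim l = 2%N.

Definition lines_have_at_least (m : nat) : Prop :=
  forall l, is_line l -> exists s : seq {vspace V},
    [/\ uniq s, (m <= size s)%N & forall p, p \in s -> is_point p /\ (p <= l)%VS].

Variable xi : {symmetric V}.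

Definition perp (u w : {vspace V}) : Prop := (u <= orthov xi w)%VS.

Definition selfconjugate (p : {vspace V}) : Prop := is_point p /\ perp p p.

Definition contained_in_H (u : {vspace V}) : Prop :=
  forall p, is_point p -> (p <= u)%VS -> selfconjugate p.

(* H is the set of selfconjugate points; its pole b is determined by b^perp = H. *)
Definition is_pole_of_H (b : {vspace V}) : Prop :=
  is_point b /\ forall p, is_point p -> (perp p b <-> selfconjugate p).

Definition Rad (u : {vspace V}) : {vspace V} := (u :&: orthov xi u)%VS.

Definition regular (u : {vspace V}) : Prop := Rad u = 0%VS.

Definition projective_space : structure {vspace V} pl_language :=
  pl_structure is_point is_line.

(* An affine line is identified with the projective line that contains it. *)
Definition affine_space : structure {vspace V} pl_language :=
  pl_structure (fun p => is_point p /\ regular p)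
               (fun l => is_line l /\ ~ contained_in_H l).

Definition structure_B1 : structure {vspace V} pl_language :=
  pl_structure (fun p => [/\ is_point p, regular p & ~ is_pole_of_H p])
               (fun l => [/\ is_line l, regular l & ~ contained_in_H l]).

End PointLine.

Arguments projective_space {F} V.
Arguments lines_have_at_least {F} V m.

(* In characteristic 0 the condition is void, as it should be. *)
Definition perfect_field (F : fieldType) : Prop :=
  forall p, p \in [pchar F] -> forall x : F, exists y, y ^+ p = x.

(* Main.v *)
From HB Require Import structures.
Require Import Defs.
From mathcomp Require Import all_boot all_order all_algebra ring.
From Stdlib Require Import Classical FunctionalExtensionality.

(** Perfectness makes u |-> sqrt (xi u u) a linear functional, and
    nondegeneracy represents it by a vector [w]: xi u u = lam u ^ 2 with
    lam u = xi u w.  Hence H is the kernel of [lam] and the pole is <[w]>.  The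
    form eta u v = xi u v + lam u * lam v is alternating, its radical is
    contained in <[w]>, and contains [w] as soon as lam w = 1.  Every point off H
    is spanned by a unique vector [u] with lam u = 1, and in terms of these
    vectors B1 has the points u <> w, with distinct [u] and [v] on a common line
    exactly when eta u v is nonzero ([B1_pointP], [B1_lineP]).

    Every relation needed is then defined from this geometry in stages.
    - Distinct points are on no common line of B1 exactly when they are
      eta-orthogonal, so orthogonality is definable.
    - The lines missing from B1 are the eta-isotropic ones.  Take [u], [v]
      orthogonal and [k] joined to both.  In the affine plane of [u], [v], [k],
      the points orthogonal to [u] and [v] are those of the line uv, and a point
      of the plane is recognised from a line of B1 through it that meets the
      lines uk and vk in distinct points ([isotropic_online]).
      Collinearity of points of B1 in the affine space is thus definable.
    - The pole is not a point of B1, but it is on the line uv exactly when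
      every point orthogonal to [u] is orthogonal to [v] ([w_online]).
    - Coplanarity, parallelism of lines and parallelism of a line and a plane
      are expressed by collinearity in the usual way, except that lines that
      meet in the pole must be told apart from parallel ones ([inplaneP],
      [parallelP], [parallel_planeP]).

    An affine point, the pole when it is affine, an affine line, a point of H
    and a line of H are represented by triples of points of B1.  For any two
    such representatives, inclusion of the represented subspaces is one of
    the relations above ([includedP]).  Equality is inclusion both ways, and a
    line of B1 is the affine line through any two points of B1 on it, so
    inclusions suffice for every clause of definability
    ([definable_in_of_kinds]). *)
Set Implicit Arguments.
Unset Strict Implicit.
Unset Printing Implicit Defensive.

Import GRing.Theory VectorInternalTheory.
Local Open Scope ring_scope.

(** The tactics [ring] and [field] work on scalars only, so an identity between
    linear combinations of vectors is checked on coordinates. *)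
Ltac by_coordinates :=
  apply: v2r_inj; apply/rowP => ?;
  rewrite ?(linearD, linearN, linearZ) /= ?mxE.

(** * Renaming the variables of a formula *)
Fixpoint rename (L : language) (X Y : Type) (g : X -> Y) (phi : formula L X) :
    formula L Y :=
  match phi with
  | FEq x y => FEq (g x) (g y)
  | FRel s v => FRel s (fun i => g (v i))
  | FNot p => FNot (rename g p)
  | FAnd p q => FAnd (rename g p) (rename g q)
  | FOr p q => FOr (rename g p) (rename g q)
  | FImp p q => FImp (rename g p) (rename g q)
  | FAll p => FAll (rename (option_map g) p)
  | FEx p => FEx (rename (option_map g) p)
  end.

Lemma extend_rename (T X Y : Type) (g : X -> Y) (u : T) (e : Y -> T) :
  (fun x => extend u e (option_map g x)) = extend u (fun x => e (g x)).
Proof. by apply: functional_extensionality => -[]. Qed.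

Lemma sat_rename (T : Type) (L : language) (M : structure T L) (X Y : Type)
    (g : X -> Y) (phi : formula L X) (e : Y -> T) :
  sat M (rename g phi) e <-> sat M phi (fun x => e (g x)).
Proof.
elim: phi Y g e => //= {X} [X p IHp|X p IHp q IHq|X p IHp q IHq|X p IHp q IHq
  |X p IHp|X p IHp] Y g e.
- by rewrite IHp.
- by rewrite IHp IHq.
- by rewrite IHp IHq.
- by rewrite IHp IHq.
- by split=> h u du; move: (h u du); rewrite (IHp _ (option_map g)) extend_rename.
- by split=> -[u du h]; exists u => //; move: h;
    rewrite (IHp _ (option_map g)) extend_rename.
Qed.

(** * Points and lines as spans of vectors *)
Section Spans.

Variables (F : fieldType) (V : vectType F).
Implicit Types (U : {vspace V}) (u v : V).

Lemma lineZ (c : F) v : c != 0 -> <[c *: v]>%VS = <[v]>%VS.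
Proof.
move=> c0; apply/eqP; rewrite eqEsubv -!memvE memvZ ?memv_line //=.
by rewrite -{1}(scalerK c0 v) memvZ ?memv_line.
Qed.

Lemma is_pointP U : is_point U -> exists2 u, u != 0 & U = <[u]>%VS.
Proof.
move=> dU; have u0 : vpick U != 0 by rewrite vpick0 -dimv_eq0 dU.
exists (vpick U) => //; apply/esym/eqP; rewrite eqEdim -memvE memv_pick.
by rewrite dim_vline u0 dU.
Qed.

Lemma mem_span2l u v : u \in (<[u]> + <[v]>)%VS.
Proof. by rewrite memvE addvSl. Qed.

Lemma mem_span2r u v : v \in (<[u]> + <[v]>)%VS.
Proof. by rewrite memvE addvSr. Qed.

Lemma dim_add_line u v : u != 0 -> v \notin <[u]>%VS ->
  \dim (<[u]> + <[v]>) = 2%N.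
Proof.
move=> u0 vu; rewrite dimv_disjoint_sum ?dim_vline ?u0.
  by rewrite (_ : v != 0) //; apply: contraNneq vu => ->; rewrite mem0v.
apply/eqP; rewrite -subv0; apply/subvP => z.
rewrite memv_cap => /andP[zu /vlineP[c zE]]; rewrite memv0 zE.
have [->|c0] := eqVneq c 0; first by rewrite scale0r.
by case/negP: vu; rewrite -[v](scalerK c0) -zE memvZ.
Qed.

Lemma is_lineE U u v : is_line U -> u \in U -> v \in U -> u != 0 ->
  v \notin <[u]>%VS -> U = (<[u]> + <[v]>)%VS.
Proof.
move=> dU uU vU u0 vu; apply/esym/eqP; rewrite eqEdim subv_add -!memvE uU vU.
by rewrite dim_add_line // dU.
Qed.

Lemma line_other U u : (2 <= \dim U)%N -> exists2 v, v \in U & v \notin <[u]>%VS.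
Proof.
move=> dU; have /subvPn[v vU vu] : ~~ (U <= <[u]>)%VS; last by exists v.
apply/negP => /dimvS le; have := leq_trans dU le.
by rewrite dim_vline; case: (u != 0).
Qed.

(** The points of the line spanned by [u] and [v] are <[v]> and the
    <[u + c *: v]>, one more than there are scalars. *)
Lemma five_scalars_of_points : (2 <= \dim {:V})%N -> lines_have_at_least V 6 ->
  forall s : seq F, (size s <= 4)%N -> exists c, c \notin s.
Proof.
move=> dV lines6 s ss; apply: NNPP => no.
have ins c : c \in s by apply/negPn/negP => cs; apply: no; exists c.
have [u _ un] := line_other 0 dV.
have u0 : u != 0 by apply: contraNneq un => ->; apply: mem0v.
have [v _ vu] := line_other u dV.
have [ps [ups sp on]] := lines6 _ (dim_add_line u0 vu).
have: (6 <= size (<[v]>%VS :: [seq <[u + c *: v]>%VS | c <- s]))%N.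
  apply: leq_trans sp (uniq_leq_size ups _) => p /on[/is_pointP[x x0 ->]].
  rewrite -memvE inE => /memv_addP[_ /vlineP[a ->] [_ /vlineP[b ->] xE]].
  have eqline (y : V) (c : F) : c != 0 -> x = c *: y -> <[x]>%VS = <[y]>%VS.
    by move=> c0 ->; apply: lineZ.
  have [a0|a0] := eqVneq a 0; [apply/orP; left | apply/orP; right].
    have b0 : b != 0.
      by apply: contraNneq x0 => b0; rewrite xE a0 b0 !scale0r addr0.
    by apply/eqP/(eqline _ b) => //; rewrite xE a0 scale0r add0r.
  apply/mapP; exists (b / a) => //; apply: (eqline _ a) => //.
  by rewrite xE scalerDr scalerA mulrCA divff // mulr1.
by rewrite /= size_map ltnS ltnNge ss.
Qed.

End Spans.

(** * Kinds of representatives *)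

(** Affine points and lines, the pole, and points and lines at infinity, that
    is, contained in the hyperplane H. *)
Inductive kind := AffPt | Pole | AffLn | InfPt | InfLn.

Definition ord_of_kind (t : kind) : 'I_5 :=
  match t with
  | AffPt => @Ordinal 5 0 isT | Pole => @Ordinal 5 1 isT
  | AffLn => @Ordinal 5 2 isT | InfPt => @Ordinal 5 3 isT
  | InfLn => @Ordinal 5 4 isT
  end.

Definition kind_of_ord (i : 'I_5) : kind :=
  nth AffPt [:: AffPt; Pole; AffLn; InfPt; InfLn] i.

Lemma ord_of_kindK : cancel ord_of_kind kind_of_ord. Proof. by case. Qed.

HB.instance Definition _ := Finite.copy kind (can_type ord_of_kindK).

Definition line_kind (t : kind) : bool :=
  match t with AffLn | InfLn => true | _ => false end.

Definition fst3 : 'I_3 := @Ordinal 3 0 isT.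
Definition snd3 : 'I_3 := @Ordinal 3 1 isT.
Definition trd3 : 'I_3 := @Ordinal 3 2 isT.

Lemma forall3 (P : 'I_3 -> Prop) : P fst3 -> P snd3 -> P trd3 -> forall m, P m.
Proof.
move=> P0 P1 P2 [[|[|[|m]]] // lt_m].
- by rewrite (_ : Ordinal lt_m = fst3) //; apply: val_inj.
- by rewrite (_ : Ordinal lt_m = snd3) //; apply: val_inj.
- by rewrite (_ : Ordinal lt_m = trd3) //; apply: val_inj.
Qed.

Definition triple (T : Type) (x0 x1 x2 : T) (m : 'I_3) : T :=
  match val m with 0%N => x0 | 1%N => x1 | _ => x2 end.

(** * The affine geometry of an alternating form *)
Section Geometry.

Variables (F : fieldType) (V : vectType F).
Implicit Types (a b c : F) (u v x y z p q r k d : V).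

Hypothesis five_scalars :
  forall s : seq F, (size s <= 4)%N -> exists c, c \notin s.

(* The hyperplane at infinity is the kernel of [lam].  The radical of [eta] is
   zero, or is spanned by [w]; in the second case [w] is an affine point. *)
Variables (lam : V -> F) (eta : V -> V -> F) (w : V).
Hypothesis lam_linear : forall a u v, lam (a *: u + v) = a * lam u + lam v.
Hypothesis eta_linear :
  forall a u v z, eta (a *: u + v) z = a * eta u z + eta v z.
Hypothesis eta_anti : forall u v, eta u v = - eta v u.
Hypothesis eta_alt : forall u, eta u u = 0.
Hypothesis eta_rad : forall r, (forall z, eta z r = 0) -> r = lam r *: w.
Hypothesis eta_w : lam w = 1 -> forall z, eta z w = 0.

Lemma lamD u v : lam (u + v) = lam u + lam v.
Proof. by rewrite -[u in LHS]scale1r lam_linear mul1r. Qed.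
Lemma lam0 : lam 0 = 0.
Proof. by apply: (addIr (lam 0)); rewrite -lamD !add0r. Qed.
Lemma lamZ a u : lam (a *: u) = a * lam u.
Proof. by rewrite -[_ *: _]addr0 lam_linear lam0 addr0. Qed.
Lemma lamN u : lam (- u) = - lam u.
Proof. by rewrite -scaleN1r lamZ mulN1r. Qed.
Definition lamE := (lamD, lamN, lamZ, lam0).

Lemma etaDl u v z : eta (u + v) z = eta u z + eta v z.
Proof. by rewrite -[u in LHS]scale1r eta_linear mul1r. Qed.
Lemma eta0l z : eta 0 z = 0.
Proof. by apply: (addIr (eta 0 z)); rewrite -etaDl !add0r. Qed.
Lemma etaZl a u z : eta (a *: u) z = a * eta u z.
Proof. by rewrite -[_ *: _]addr0 eta_linear eta0l addr0. Qed.
Lemma etaNl u z : eta (- u) z = - eta u z.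
Proof. by rewrite -scaleN1r etaZl mulN1r. Qed.
Lemma etaDr z u v : eta z (u + v) = eta z u + eta z v.
Proof. by rewrite 3![eta z _]eta_anti etaDl opprD. Qed.
Lemma etaZr z a u : eta z (a *: u) = a * eta z u.
Proof. by rewrite 2![eta z _]eta_anti etaZl mulrN. Qed.
Lemma etaNr z u : eta z (- u) = - eta z u.
Proof. by rewrite -scaleN1r etaZr mulN1r. Qed.
Definition etaE :=
  (etaDl, etaNl, etaZl, eta0l, etaDr, etaNr, etaZr, eta_alt).

Lemma eta_eq0C u v : eta u v = 0 <-> eta v u = 0.
Proof. by split=> e; rewrite eta_anti e oppr0. Qed.

(** Points of B1 are identified with their representatives normalised by
    lam u = 1, so that lines become sets of affine combinations.  The
    second condition removes the pole. *)
Definition pt u : bool := (lam u == 1) && (u != w).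

Lemma ptP u : pt u -> lam u = 1. Proof. by case/andP=> /eqP. Qed.
Lemma pt_neq u : pt u -> u <> w. Proof. by case/andP=> _ /eqP. Qed.

(** A vector that is not orthogonal to everything cannot be the pole, because
    the pole is radical as soon as it is affine. *)
Lemma ptI u v : lam u = 1 -> eta v u != 0 -> pt u.
Proof.
move=> lu e; rewrite /pt lu eqxx /=; apply: contraNneq e => uw.
by rewrite uw eta_w // -uw.
Qed.

Lemma pt_nonrad u : pt u -> exists z, eta z u != 0.
Proof.
move=> pu; apply: NNPP => no; apply: (pt_neq pu).
rewrite [LHS]eta_rad ?ptP ?scale1r // => z; apply/eqP/negPn/negP => e.
by apply: no; exists z.
Qed.

Definition online z p q : Prop := exists t, z = p + t *: (q - p).
Definition on_regular z p q : Prop := eta p q <> 0 /\ online z p q.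

Lemma lam_online z p q : online z p q -> lam p = 1 -> lam q = 1 -> lam z = 1.
Proof. by move=> [t ->] lp lq; rewrite !lamE lp lq; ring. Qed.

Lemma online_l p q : online p p q. Proof. by exists 0; rewrite scale0r addr0. Qed.
Lemma online_r p q : online q p q.
Proof. by exists 1; rewrite scale1r addrC subrK. Qed.

Lemma online_pt z p : online z p p <-> z = p.
Proof.
split=> [[t ->]|->]; last exact: online_l.
by rewrite subrr scaler0 addr0.
Qed.

(** At most three hyperplanes u^perp and H do not cover the space: move from a
    vector [k] that avoids the earlier ones along a vector [z] that avoids the
    new one.  Each of the at most four conditions excludes one scalar. *)
Lemma exists_joined o (s : seq V) : lam o = 1 -> (size s <= 3)%N ->
  (forall u, u \in s -> exists z, eta z u != 0) ->
  exists k, lam k = 1 /\ forall u, u \in s -> eta k u != 0.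
Proof.
move=> lo ss ns.
suff [k [lk hk]] : exists k, lam k != 0 /\ forall u, u \in s -> eta k u != 0.
  exists ((lam k)^-1 *: k); rewrite lamZ mulVf //; split=> // u us.
  by rewrite etaZl mulf_neq0 ?invr_eq0 ?hk.
elim: s ss ns => [_ _|u s IHs ss ns].
  by exists o; rewrite lo oner_neq0.
have [k [lk hk]] : exists k, lam k != 0 /\ forall u, u \in s -> eta k u != 0.
  by apply: IHs => [|v vs]; [exact: ltnW | apply: ns; rewrite inE vs orbT].
have [z hz] := ns u (mem_head _ _).
have [|t] := five_scalars (s := [:: - (lam k / lam z), - (eta k u / eta z u)
  & [seq - (eta k v / eta z v) | v <- s]]).
  by rewrite /= size_map.
rewrite !inE !negb_or => /and3P[tl tu ts].
have avoid (a b : F) : a != 0 -> t != - (a / b) -> a + t * b != 0.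
  move=> a0; apply: contraNneq => e; have b0 : b != 0.
    by apply: contraNneq a0 => b0; rewrite -e b0 mulr0 addr0.
  by apply/eqP; apply: (mulIf b0); rewrite mulNr divfK // -[RHS]add0r -e; ring.
exists (k + t *: z); split; first by rewrite !lamE avoid.
move=> v; rewrite inE !etaE => /predU1P[->|vs].
  have [k0|k0] := eqVneq (eta k u) 0; last exact: avoid.
  rewrite k0 add0r mulf_neq0 //.
  by apply: contraNneq tu => ->; rewrite k0 mul0r oppr0.
apply: avoid; first exact: hk.
by apply: contraNneq ts => ->; apply/mapP; exists v.
Qed.

(** Lines of B1 in the plane of [u], [v], [k] recover the isotropic line uv.
    Conversely, if [x] is in that plane and orthogonal to [u], then its
    coordinate along [k] vanishes, as eta k u is nonzero.  For the direct
    implication, [k] is chosen off x^perp as well, so that [x] is not the radical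
    of [eta] on the plane and the lines through [x], other than uv, belong to B1. *)
Lemma isotropic_online u v x : pt u -> pt v -> pt x -> eta u v = 0 ->
  online x u v <->
  (x = u \/ x = v) \/ (eta x u = 0 /\ eta x v = 0) /\
  exists k, pt k /\ exists y1, pt y1 /\ exists y2, pt y2 /\
    [/\ on_regular y1 u k, on_regular y2 v k & on_regular x y1 y2].
Proof.
move=> pu pv px uv; split; last first.
  case=> [[->|->]|[[xu xv] [k [_ [y1 [_ [y2 [_ [[uk h1] [vk h2] [_ h3]]]]]]]]]].
  - exact: online_l.
  - exact: online_r.
  have [a e1] := h1; have [b e2] := h2; have [c e3] := h3.
  have eC : ((1 - c) * a + c * b) * eta k u = 0.
    rewrite -[RHS]xu e3 e1 e2 !etaE [eta v u]eta_anti uv; ring.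
  have C0 : (1 - c) * a + c * b = 0.
    apply/eqP; move/eqP: eC; rewrite mulf_eq0 => /orP[//|/eqP ku].
    by case: uk; rewrite eta_anti ku oppr0.
  exists (c * (1 - b)).
  have -> : x = u + (c * (1 - b)) *: (v - u) + ((1 - c) * a + c * b) *: (k - u).
    by rewrite e3 e1 e2; by_coordinates; ring.
  by rewrite C0 scale0r addr0.
move=> [s xE].
have [s0|s0] := eqVneq s 0; first by left; left; rewrite xE s0 scale0r addr0.
have [s1|s1] := eqVneq s 1.
  by left; right; rewrite xE s1 scale1r addrC subrK.
right; split.
  by rewrite xE !etaE [eta v u]eta_anti uv; split; ring.
have [|k [lk hk]] := @exists_joined u [:: u; v; x] (ptP pu) isT.
  by move=> z; rewrite !inE => /or3P[] /eqP->; apply: pt_nonrad.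
have ku : eta k u != 0 by apply: hk; rewrite !inE eqxx.
have kv : eta k v != 0 by apply: hk; rewrite !inE eqxx orbT.
have kx : eta k x != 0 by apply: hk; rewrite !inE eqxx !orbT.
have uk : eta u k != 0 by rewrite eta_anti oppr_eq0.
have vk : eta v k != 0 by rewrite eta_anti oppr_eq0.
have [//|c] := @five_scalars [:: 0; 1; s].
rewrite !inE !negb_or => /and3P[c0 c1 cs].
have c1' : 1 - c != 0 by rewrite subr_eq0 eq_sym.
have cs' : s - c != 0 by rewrite subr_eq0 eq_sym.
(* The lines through [x] in the plane are indexed by a ratio [c]: [y1] and [y2]
   are the points of uk and vk with x = (1 - c) y1 + c y2.  The excluded values
   c = 0, 1, s give the parallels to vk and to uk, and the line uv itself. *)
pose y1 := u + ((s - c) / (1 - c)) *: (k - u).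
pose y2 := v + ((c - s) / c) *: (k - v).
have ey : eta y1 y2 = (s - c) / (c * (1 - c)) * eta k x.
  rewrite /y1 /y2 xE !etaE [eta u k]eta_anti uv.
  by field; rewrite ?c0 ?c1'.
exists k; split; first by apply: (@ptI _ u).
exists y1; split.
  apply: (@ptI _ u); first by rewrite !lamE lk (ptP pu); ring.
  by rewrite !etaE subr0 add0r !mulf_neq0 ?invr_eq0.
exists y2; split.
  apply: (@ptI _ v); first by rewrite !lamE lk (ptP pv); ring.
  by rewrite !etaE subr0 add0r !mulf_neq0 ?invr_eq0 // -opprB oppr_eq0.
split.
- by split; [apply/eqP | exists ((s - c) / (1 - c))].
- by split; [apply/eqP | exists ((c - s) / c)].
split; first by apply/eqP; rewrite ey !mulf_neq0 ?invr_eq0 ?mulf_neq0.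
exists c; rewrite xE /y1 /y2; by_coordinates.
by field; rewrite ?c0 ?c1'.
Qed.

Lemma online_cases u v x : pt u -> pt v -> pt x ->
  online x u v <->
  on_regular x u v \/ eta u v = 0 /\
  ((x = u \/ x = v) \/ (eta x u = 0 /\ eta x v = 0) /\
  exists k, pt k /\ exists y1, pt y1 /\ exists y2, pt y2 /\
    [/\ on_regular y1 u k, on_regular y2 v k & on_regular x y1 y2]).
Proof.
move=> pu pv px; have [uv|/eqP uv] := eqVneq (eta u v) 0.
  rewrite isotropic_online // /on_regular uv; split; first by right.
  by case=> [[]|[]].
by rewrite /on_regular; split=> [|[[]|[/uv]]] //; left.
Qed.

(** The hyperplane u^perp is spanned by its affine points, as [u] is one of them.
    So the condition means u^perp = v^perp, that is, a combination of [u] and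
    [v] is radical, and the radical is contained in <[w]>. *)
Lemma w_online u v : pt u -> pt v -> u <> v ->
  online w u v <-> forall z, pt z -> eta z u = 0 -> eta z v = 0.
Proof.
move=> pu pv uv; split=> [wuv z pz zu|zuv].
  have lw := lam_online wuv (ptP pu) (ptP pv); have [t wE] := wuv.
  have := eta_w lw z; rewrite wE !etaE zu => /eqP.
  rewrite subr0 add0r mulf_eq0 => /orP[/eqP t0|/eqP //].
  by case: (pt_neq pu); rewrite wE t0 scale0r addr0.
have uvH z : lam z = 1 -> eta z u = 0 -> eta z v = 0.
  move=> lz zu; have [zw|zw] := eqVneq z w.
    by apply/eta_eq0C; rewrite zw eta_w -?zw.
  by apply: zuv => //; rewrite /pt lz eqxx.
have uvA z : eta z u = 0 -> eta z v = 0.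
  move=> zu; have [lz|lz] := eqVneq (lam z) 0.
    have := uvH (z + u); rewrite lamD !etaDl eta_alt zu lz (ptP pu) !add0r.
    by rewrite (uvH u) ?ptP // addr0; apply.
  have := uvH ((lam z)^-1 *: z); rewrite !etaZl zu lamZ mulVf // mulr0.
  move=> /(_ erefl erefl)/eqP; rewrite mulf_eq0 invr_eq0 (negPf lz) /=.
  by move/eqP.
have [z0 hz] := pt_nonrad pu; pose c := eta z0 v / eta z0 u.
have := @eta_rad (v - c *: u); rewrite !lamE (ptP pu) (ptP pv) mulr1 => rE.
have {}rE : v - c *: u = (1 - c) *: w.
  apply: rE => z; have := uvA (z - (eta z u / eta z0 u) *: z0).
  rewrite !etaE /c divfK // subrr => /(_ erefl) <-; field; exact: hz.
have [c1|c1] := eqVneq (1 - c) 0.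
  case: uv; apply/esym/eqP; rewrite -subr_eq0; apply/eqP; move: rE.
  by move/eqP: c1; rewrite subr_eq0 => /eqP<-; rewrite subrr !(scale0r, scale1r).
exists ((1 - c)^-1); apply: (scalerI c1); rewrite -rE.
by by_coordinates; field.
Qed.

(** A line through [p] is in the pole for at most one value of its parameter.
    That parameter is written a / c because in the constructions below it is a
    given coordinate divided by a ratio that can be chosen. *)
Lemma avoid_w p d a : p <> w ->
  exists c0, forall c, c != 0 -> c != c0 -> p + (a / c) *: d <> w.
Proof.
move=> pw; have [[t wE]|no] := classic (exists t, p + t *: d = w); last first.
  by exists 0 => c _ _ wE; apply: no; exists (a / c).
exists (a / t) => c c0 ct; rewrite -wE => /addrI e.
have [d0|d0] := eqVneq d 0.
  by apply: pw; rewrite -wE d0 scaler0 addr0.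
have tE : a / c = t.
  by apply/eqP; rewrite -subr_eq0; move/eqP: e; rewrite -subr_eq0 -scalerBl
     scaler_eq0 (negPf d0) orbF.
have [t0|t0] := eqVneq t 0; first by apply: pw; rewrite -wE t0 scale0r addr0.
by case/eqP: ct; rewrite -(divfK c0 a) tE mulrAC divff // mul1r.
Qed.

Lemma shift_pt p h : pt p -> lam h = 0 -> exists2 c, c != 0 & pt (p + c *: h).
Proof.
move=> pp h0; have [c0 hc] := avoid_w h 1 (pt_neq pp).
have [//|c] := @five_scalars [:: 0; c0]; rewrite !inE negb_or => /andP[n0 nc].
exists (1 / c); first by rewrite div1r invr_eq0.
by rewrite /pt !lamE h0 (ptP pp) mulr0 addr0 eqxx; apply/eqP/hc.
Qed.

Definition inplane y p q r : Prop :=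
  exists a b, y = p + a *: (q - p) + b *: (r - p).

(** A generic line through [y] in the plane meets pq and pr in points of B1.
    Five scalars are enough: two values of the ratio [c] put an intersection at
    infinity, and at most two put it in the pole. *)
Lemma inplaneP y p q r : pt p -> pt q -> pt r ->
  inplane y p q r <->
  exists y1, pt y1 /\ exists y2, pt y2 /\
    [/\ online y1 p q, online y2 p r & online y y1 y2].
Proof.
move=> pp pq pr; split; last first.
  move=> [_ [_ [_ [_ [[a ->] [b ->] [c ->]]]]]].
  by exists ((1 - c) * a), (c * b); by_coordinates; ring.
move=> [a [b ->]].
have [c1 h1] := avoid_w (q - p) a (pt_neq pp).
have [c2 h2] := avoid_w (r - p) b (pt_neq pp).
have [//|c] := @five_scalars [:: 0; 1; 1 - c1; c2].
rewrite !inE !negb_or => /and4P[c0 c11 cc1 cc2].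
have c1' : 1 - c != 0 by rewrite subr_eq0 eq_sym.
have cc1' : 1 - c != c1.
  by apply: contraNneq cc1 => <-; apply/eqP; ring.
exists (p + (a / (1 - c)) *: (q - p)); split.
  rewrite /pt !lamE !ptP //; apply/andP; split; first by apply/eqP; ring.
  by apply/eqP/h1.
exists (p + (b / c) *: (r - p)); split.
  rewrite /pt !lamE !ptP //; apply/andP; split; first by apply/eqP; ring.
  by apply/eqP/h2.
split; [by eexists | by eexists | exists c].
by by_coordinates; field; rewrite ?c0 ?c1'.
Qed.

Definition parallel p q x y : Prop := exists c, q - p = c *: (y - x).

(** Lines are parallel when they are coplanar and have no common affine point.
    Quantification over points of B1 overlooks only the pole, which is why its
    incidence with both lines is excluded separately. *)
Lemma parallelP p q x y : pt p -> pt q -> pt x -> pt y -> p <> q -> x <> y ->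
  parallel p q x y <->
  (online x p q /\ online y p q) \/
  [/\ inplane y p q x,
      ~ (exists z, pt z /\ (online z p q /\ online z x y)) &
      ~ (online w p q /\ online w x y)].
Proof.
move=> pp pq px py pq' xy'; split.
  move=> [c e].
  have c0 : c != 0.
    apply/eqP => c0; case: pq'; apply/esym/eqP; rewrite -subr_eq0 e c0.
    by rewrite scale0r.
  have e' : y - x = c^-1 *: (q - p) by rewrite e scalerA mulVf // scale1r.
  have yE : y = x + c^-1 *: (q - p) by rewrite -e' addrC subrK.
  have [[t xE]|xpq] := classic (online x p q).
    left; split; first by exists t.
    by exists (t + c^-1); rewrite yE {1}xE scalerDl addrA.
  have noz z : ~ (online z p q /\ online z x y).
    move=> [[a zE] [b zE']]; apply: xpq; exists (a - b / c).
    rewrite -[x](addrK (b *: (y - x))) -zE' zE e' scalerA.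
    by by_coordinates; ring.
  right; split; [|by move=> [z [_ /noz]]|by move/noz].
  by exists c^-1, 1; rewrite yE; by_coordinates; ring.
case=> [[[a xE] [b yE]]|[[a [b yE]] noz now]].
  have ba : b - a != 0.
    rewrite subr_eq0; apply/eqP => ba; apply: xy'; rewrite xE yE ba.
    by [].
  exists ((b - a)^-1); rewrite xE yE; by_coordinates; field; exact: ba.
have [b1|b1] := eqVneq b 1.
  have a0 : a != 0.
    apply/eqP => a0; apply: xy'; rewrite yE a0 b1; by_coordinates; ring.
  exists a^-1; rewrite yE b1; by_coordinates; field; exact: a0.
have b1' : 1 - b != 0 by rewrite subr_eq0 eq_sym.
have onl : online (p + (a / (1 - b)) *: (q - p)) p q by eexists.
have [zw|zw] := eqVneq (p + (a / (1 - b)) *: (q - p)) w.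
  case: now; rewrite -zw; split=> //; exists ((1 - b)^-1).
  by rewrite yE; by_coordinates; field.
case: noz; exists (p + (a / (1 - b)) *: (q - p)); split.
  by rewrite /pt zw andbT (lam_online onl) ?ptP.
split=> //; exists ((1 - b)^-1).
by rewrite yE; by_coordinates; field.
Qed.

Definition parallel_plane x y p q r : Prop :=
  exists a b, y - x = a *: (q - p) + b *: (r - p).

(** Translate the direction y - x to [p]: the third point [z] of this line
    inside the plane only has to avoid the pole. *)
Lemma parallel_planeP x y p q r : pt x -> pt y -> pt p -> pt q -> pt r ->
  x <> y ->
  parallel_plane x y p q r <->
  exists z, pt z /\ [/\ p <> z, parallel x y p z & inplane z p q r].
Proof.
move=> px py pp pq pr xy; split; last first.
  move=> [z [_ [_ [c e] [a [b zE]]]]]; exists (c * a), (c * b).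
  by rewrite e zE; by_coordinates; ring.
move=> [a [b e]].
have [|c c0 pz] := @shift_pt p (y - x) pp.
  by rewrite !lamE !ptP // subrr.
exists (p + c *: (y - x)); split=> //; split.
- move/eqP; rewrite eq_sym -subr_eq0 addrC addKr scaler_eq0 (negPf c0) /=.
  by rewrite subr_eq0 => /eqP/esym.
- exists c^-1; rewrite [p + _]addrC addrK scalerA mulVf // scale1r //.
exists (c * a), (c * b); rewrite e; by_coordinates; ring.
Qed.


(** * Definable relations between points of B1 *)

(* The points and lines of B1, as they appear in a structure on subspaces. *)
Variables (Pt Ln : {vspace V} -> Prop).
Hypothesis PtE : forall U, Pt U <-> exists2 u, pt u & U = <[u]>%VS.
Hypothesis LnE : forall U, Ln U <-> exists u v,
  [/\ pt u, pt v, eta u v <> 0 & U = (<[u]> + <[v]>)%VS].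

Local Notation M := (pl_structure Pt Ln).

(** The normalised vector that spans an affine point. *)
Definition rep U : V := (lam (vpick U))^-1 *: vpick U.

Lemma rep_line u : lam u = 1 -> rep <[u]>%VS = u.
Proof.
move=> lu; have u0 : u != 0.
  by apply/eqP => u0; move/eqP: lu; rewrite u0 lam0 eq_sym oner_eq0.
have /vlineP[c cE] := memv_pick <[u]>%VS.
have c0 : c != 0.
  by apply: contraNneq u0 => c0; rewrite -memv0 -[0%VS](_ : <[u]>%VS = _) ?memv_line //;
  apply/eqP; rewrite -vpick0 cE c0 scale0r.
by rewrite /rep cE lamE lu mulr1 scalerA mulVf // scale1r.
Qed.

Lemma rep_pt U : Pt U -> pt (rep U).
Proof. by case/PtE => u pu ->; rewrite rep_line // (ptP pu). Qed.

Lemma repK U : Pt U -> <[rep U]>%VS = U.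
Proof. by case/PtE => u pu ->; rewrite rep_line // (ptP pu). Qed.

Lemma Pt_line u : pt u -> Pt <[u]>%VS.
Proof. by move=> pu; apply/PtE; exists u. Qed.

(** Definability of a relation between normalised vectors.  The formula only has
    to be correct when all its free variables denote points, so that quantifiers
    relativised to points correspond to quantifiers over [pt]. *)
Definition definable (X : Type) (P : (X -> V) -> Prop) : Prop :=
  exists phi : formula pl_language X, forall a : X -> {vspace V},
    (forall i, Pt (a i)) -> (sat M phi a <-> P (fun i => rep (a i))).

Lemma definable_ext X (P Q : (X -> V) -> Prop) :
  (forall e, (forall i, pt (e i)) -> P e <-> Q e) -> definable P -> definable Q.
Proof.
move=> PQ [phi phiP]; exists phi => a pa; rewrite phiP //.
by apply: PQ => i; apply: rep_pt.
Qed.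

Lemma definable_not X (P : (X -> V) -> Prop) :
  definable P -> definable (fun e => ~ P e).
Proof. by move=> [p pP]; exists (FNot p) => a /pP <-. Qed.

Lemma definable_and X (P Q : (X -> V) -> Prop) :
  definable P -> definable Q -> definable (fun e => P e /\ Q e).
Proof. by move=> [p pP] [q qP]; exists (FAnd p q) => a pa; rewrite -pP -?qP. Qed.

Lemma definable_or X (P Q : (X -> V) -> Prop) :
  definable P -> definable Q -> definable (fun e => P e \/ Q e).
Proof. by move=> [p pP] [q qP]; exists (FOr p q) => a pa; rewrite -pP -?qP. Qed.

Lemma definable_imp X (P Q : (X -> V) -> Prop) :
  definable P -> definable Q -> definable (fun e => P e -> Q e).
Proof. by move=> [p pP] [q qP]; exists (FImp p q) => a pa; rewrite -pP -?qP. Qed.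

(** Definability concerns one given structure, so a formula may be chosen
    according to a property of that structure, such as lam w = 1. *)
Lemma definable_const X (A : Prop) : definable (fun _ : X -> V => A).
Proof.
have [yes|no] := classic A; first by exists (FAll (FEq None None)).
by exists (FNot (FAll (FEq None None))) => a _; split=> //= h; case: h.
Qed.

Lemma definable_eq X (i j : X) : definable (fun e => e i = e j).
Proof.
exists (FEq i j) => a pa /=; split=> [->//|e].
by rewrite -(repK (pa i)) e repK.
Qed.

Definition is_pt (X : Type) (i : X) : formula pl_language X :=
  @FRel pl_language X IsPoint (fun _ => i).

Definition on_line (X : Type) (i l : X) : formula pl_language X :=
  @FRel pl_language X Incident (fun m => if m == ord0 then i else l).

Lemma definable_ex X (P : V -> (X -> V) -> Prop) :
  definable (fun e : option X -> V => P (e None) (fun i => e (Some i))) ->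
  definable (fun e => exists v, pt v /\ P v e).
Proof.
move=> [phi phiP]; exists (FEx (FAnd (is_pt None) phi)) => a pa /=.
have pea U : Pt U -> forall i, Pt (extend U a i) by move=> pU [].
split=> [[U _ [pU /(phiP _ (pea U pU))]]|[v [pv Pv]]].
  by exists (rep U); split=> //; apply: rep_pt.
have pV := Pt_line pv; exists <[v]>%VS; first by left.
by split=> //; apply/(phiP _ (pea _ pV)) => /=; rewrite rep_line // (ptP pv).
Qed.

Lemma definable_all X (P : V -> (X -> V) -> Prop) :
  definable (fun e : option X -> V => P (e None) (fun i => e (Some i))) ->
  definable (fun e => forall v, pt v -> P v e).
Proof.
move=> [phi phiP]; exists (FAll (FImp (is_pt None) phi)) => a pa /=.
have pea U : Pt U -> forall i, Pt (extend U a i) by move=> pU [].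
split=> [h v pv|h U _ pU].
  have pV := Pt_line pv; have := h <[v]>%VS (or_introl pV) pV.
  by move=> /(phiP _ (pea _ pV)) /=; rewrite rep_line // (ptP pv).
by apply/(phiP _ (pea U pU)); apply: h; apply: rep_pt.
Qed.

Lemma mem_line u v z : lam u = 1 -> lam v = 1 -> lam z = 1 ->
  z \in (<[u]> + <[v]>)%VS <-> online z u v.
Proof.
move=> lu lv lz; split=> [/memv_addP[_ /vlineP[a ->] [_ /vlineP[b ->] zE]]|[t ->]].
  have ab : a = 1 - b by rewrite -lz zE !lamE lu lv !mulr1 addrK.
  by exists b; rewrite zE ab; by_coordinates; ring.
have -> : u + t *: (v - u) = (1 - t) *: u + t *: v by by_coordinates; ring.
by rewrite memv_add ?memvZ ?memv_line.
Qed.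

(** The alternating form of two affine combinations of [u] and [v] is a multiple
    of eta u v by the difference of their parameters, so a line of B1 is
    spanned by any two of its affine points, and these are joined. *)
Lemma on_regular_span u v p q z : pt u -> pt v -> pt p -> pt q -> pt z -> p <> q ->
  eta u v <> 0 -> (<[p]> + <[q]> <= <[u]> + <[v]>)%VS ->
  z \in (<[u]> + <[v]>)%VS -> on_regular z p q.
Proof.
move=> pu pv pp pq pz pq' uv.
rewrite subv_add -!memvE => /andP[].
move=> /(mem_line (ptP pu) (ptP pv) (ptP pp))[s pE].
move=> /(mem_line (ptP pu) (ptP pv) (ptP pq))[t qE].
move=> /(mem_line (ptP pu) (ptP pv) (ptP pz))[r zE].
have ts : t - s != 0.
  by rewrite subr_eq0; apply/eqP => ts; apply: pq'; rewrite pE qE ts.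
split.
  have -> : eta p q = (t - s) * eta u v.
    by rewrite pE qE !etaE [eta v u]eta_anti; ring.
  by apply/eqP; rewrite mulf_neq0 //; apply/eqP.
exists ((r - s) / (t - s)); rewrite zE pE qE.
by by_coordinates; field.
Qed.

Lemma definable_on_regular X (h i j : X) :
  definable (fun e => on_regular (e h) (e i) (e j)).
Proof.
pose on m := on_line (Some m) (@None X).
exists (FEx (FAnd (on h) (FAnd (on i) (FAnd (on j)
  (FNot (FEq (Some i) (Some j))))))) => a pa.
have le m : (a m <= <[rep (a m)]>)%VS by rewrite repK.
have pr m : pt (rep (a m)) by apply: rep_pt.
split=> [[U _ [[_ LU hU] [[_ _ iU] [[_ _ jU] ij]]]]|[ij hij]].
  move: LU hU iU jU => /= /LnE[u [v [pu pv uv ->]]] hU iU jU.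
  apply: (on_regular_span pu pv) => //.
  - by move=> e; apply: ij => /=; rewrite -(repK (pa i)) e repK.
  - by rewrite subv_add !repK // iU jU.
  - by rewrite memvE repK.
have LU : Ln (<[rep (a i)]> + <[rep (a j)]>)%VS.
  by apply/LnE; exists (rep (a i)), (rep (a j)).
exists (<[rep (a i)]> + <[rep (a j)]>)%VS; first by right.
split; last split; last split.
- split=> //=; rewrite -(repK (pa h)) -memvE.
  by apply/(mem_line (ptP (pr i)) (ptP (pr j)) (ptP (pr h))).
- by split=> //=; rewrite -{1}(repK (pa i)) addvSl.
- by split=> //=; rewrite -{1}(repK (pa j)) addvSr.
by move=> /= e; apply: ij; rewrite e eta_alt.
Qed.

Lemma definable_perp X (i j : X) : definable (fun e => eta (e i) (e j) = 0).
Proof.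
apply: definable_ext (definable_not (definable_on_regular i i j)) => e _.
split=> [h|e0 [/(_ e0)]//]; apply/eqP/negPn/negP => /eqP ij.
by apply: h; split=> //; apply: online_l.
Qed.

Lemma definable_and3 X (P Q R : (X -> V) -> Prop) :
  definable P -> definable Q -> definable R ->
  definable (fun e => [/\ P e, Q e & R e]).
Proof.
move=> dP dQ dR; apply: definable_ext (definable_and dP (definable_and dQ dR)).
by move=> e _; split=> [[? []]|[]].
Qed.

Ltac definable :=
  cbv beta;
  match goal with
  | |- definable (fun _ => [/\ _, _ & _]) =>
      apply: definable_and3; definable
  | |- definable (fun _ => _ /\ _) => apply: definable_and; definable
  | |- definable (fun _ => _ \/ _) => apply: definable_or; definable
  | |- definable (fun _ => ~ _) => apply: definable_not; definable
  | |- definable (fun _ => exists v, is_true _ /\ _) =>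
      apply: definable_ex; definable
  | |- definable (fun _ => forall v, is_true _ -> _) =>
      apply: definable_all; definable
  | |- definable (fun _ => _ -> _) => apply: definable_imp; definable
  | |- definable (fun _ => _ <> _) => apply: definable_not; definable
  | |- _ => first [ exact: definable_eq | exact: definable_on_regular
                  | exact: definable_perp | idtac ]
  end.

Lemma definable_online X (h i j : X) :
  definable (fun e => online (e h) (e i) (e j)).
Proof.
apply: definable_ext.
  by move=> e pe; apply: iff_sym; apply: online_cases; apply: pe.
definable.
Qed.

Lemma definable_w_online X (i j : X) :
  definable (fun e => online w (e i) (e j)).
Proof.
apply: (@definable_ext _ (fun e => e i <> e j /\
  (forall v, pt v -> eta v (e i) = 0 -> eta v (e j) = 0))); last first.
  by definable.
move=> e pe; split=> [[ij h]|wij]; first exact/w_online.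
have ij : e i <> e j.
  by move=> ij; move: wij; rewrite ij => /online_pt /esym/(pt_neq (pe j)).
by split=> //; apply/w_online.
Qed.

Lemma definable_inplane X (h i j l : X) :
  definable (fun e => inplane (e h) (e i) (e j) (e l)).
Proof.
apply: definable_ext.
  by move=> e pe; apply: iff_sym; apply: inplaneP; apply: pe.
definable; exact: definable_online.
Qed.

Lemma definable_parallel X (h i j l : X) :
  definable (fun e => parallel (e h) (e i) (e j) (e l)).
Proof.
apply: (@definable_ext _ (fun e => e h = e i \/ (e h <> e i /\ e j <> e l /\
  ((online (e j) (e h) (e i) /\ online (e l) (e h) (e i)) \/
  [/\ inplane (e l) (e h) (e i) (e j),
      ~ (exists z, pt z /\ (online z (e h) (e i) /\ online z (e j) (e l))) &
      ~ (online w (e h) (e i) /\ online w (e j) (e l))])))); last first.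
  by definable;
    (exact: definable_online || exact: definable_inplane
     || exact: definable_w_online).
move=> e pe; split=> [[->|[hi [jl]]]|hijl].
- by exists 0; rewrite subrr scale0r.
- by move/parallelP; apply.
have [hi|hi] := classic (e h = e i); [by left | right].
have jl : e j <> e l.
  move=> jl; apply: hi; have [c] := hijl; rewrite jl subrr scaler0 => /eqP.
  by rewrite subr_eq0 => /eqP->.
by split=> //; split=> //; apply/parallelP.
Qed.

Lemma definable_parallel_plane X (h i j l m : X) :
  definable (fun e => parallel_plane (e h) (e i) (e j) (e l) (e m)).
Proof.
apply: (@definable_ext _ (fun e => e h = e i \/ (e h <> e i /\
  exists z, pt z /\ [/\ e j <> z, parallel (e h) (e i) (e j) z
                      & inplane z (e j) (e l) (e m)]))); last first.
  by definable; (exact: definable_parallel || exact: definable_inplane).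
move=> e pe; split=> [[->|[hi]]|hjlm].
- by exists 0, 0; rewrite subrr !scale0r addr0.
- by move/parallel_planeP; apply.
have [hi|hi] := classic (e h = e i); [by left | right; split=> //].
exact/parallel_planeP.
Qed.

(** * Subspaces represented by triples of points of B1 *)
Implicit Types (s t : kind) (e f : 'I_3 -> V).

(** A triple may represent the same subspace as many others, so one length of
    tuples can serve all kinds.  The pole is represented by every triple, or
    by none if it is contained in H and so already of kind [InfPt]. *)
Definition valid t e : Prop :=
  match t with
  | AffPt => True
  | Pole => lam w = 1
  | AffLn | InfPt => e fst3 <> e snd3
  | InfLn => e fst3 <> e snd3 /\ ~ online (e trd3) (e fst3) (e snd3)
  end.

(** A subspace of H is spanned by differences of normalised vectors. *)
Definition flat t e : {vspace V} :=
  match t with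
  | AffPt => <[e fst3]>
  | Pole => <[w]>
  | AffLn => <[e fst3]> + <[e snd3]>
  | InfPt => <[e snd3 - e fst3]>
  | InfLn => <[e snd3 - e fst3]> + <[e trd3 - e fst3]>
  end%VS.

(** The next three definitions express membership in [flat t f] of an affine
    point, of the pole, and of a direction, as a definable relation between
    points of B1. *)
Definition has_pt t f v : Prop :=
  match t with
  | AffPt => v = f fst3
  | AffLn => online v (f fst3) (f snd3)
  | _ => False
  end.

Definition has_w t f : Prop :=
  match t with
  | Pole => True
  | AffLn => online w (f fst3) (f snd3)
  | _ => False
  end.

Definition has_dir t f u v : Prop :=
  match t with
  | AffLn | InfPt => parallel u v (f fst3) (f snd3)
  | InfLn => parallel_plane u v (f fst3) (f snd3) (f trd3)
  | _ => False
  end.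

Definition included s t e f : Prop :=
  match s with
  | AffPt => has_pt t f (e fst3)
  | Pole => has_w t f
  | AffLn => has_pt t f (e fst3) /\ has_pt t f (e snd3)
  | InfPt => has_dir t f (e fst3) (e snd3)
  | InfLn => has_dir t f (e fst3) (e snd3) /\ has_dir t f (e fst3) (e trd3)
  end.

Lemma notin_lam0 (U : {vspace V}) v : (forall z, z \in U -> lam z = 0) -> lam v = 1 -> v \notin U.
Proof.
by move=> lU lv; apply/negP => /lU/eqP; rewrite lv oner_eq0.
Qed.

Lemma lam_dir t e : (forall m, pt (e m)) ->
  match t with InfPt | InfLn => True | _ => False end ->
  forall z, z \in flat t e -> lam z = 0.
Proof.
move=> pe; case: t => //= _ z.
  by move=> /vlineP[c ->]; rewrite !lamE !ptP // subrr mulr0.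
move=> /memv_addP[_ /vlineP[a ->] [_ /vlineP[b ->] ->]].
by rewrite !lamE !ptP // subrr !mulr0 addr0.
Qed.

Lemma line1P u v : lam u = 1 -> lam v = 1 -> v \in <[u]>%VS <-> v = u.
Proof.
move=> lu lv; split=> [/vlineP[c vE]|->]; last exact: memv_line.
by move: lv; rewrite vE lamE lu mulr1 => ->; rewrite scale1r.
Qed.

Lemma has_ptP t f v : (forall m, pt (f m)) -> valid t f -> pt v ->
  v \in flat t f <-> has_pt t f v.
Proof.
move=> pf vf pv; have lv := ptP pv.
case: t vf => [_|lw|_|_|_]; rewrite /has_pt.
- by apply: line1P; rewrite ?ptP.
- by split=> // /line1P; move=> /(_ lw lv)/(pt_neq pv).
- by apply: mem_line; rewrite ?ptP.
- by split=> //; apply/negP/notin_lam0 => //; apply: lam_dir.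
- by split=> //; apply/negP/notin_lam0 => //; apply: lam_dir.
Qed.

Lemma has_wP t f : (forall m, pt (f m)) -> lam w = 1 ->
  w \in flat t f <-> has_w t f.
Proof.
move=> pf lw; case: t; rewrite /has_w /=.
- by split=> // /line1P; rewrite ptP // => /(_ erefl lw)/esym/(pt_neq (pf _)).
- by split=> // _; apply: memv_line.
- by apply: mem_line => //; apply: ptP.
- by split=> //; apply/negP/notin_lam0 => //; apply: (@lam_dir InfPt f).
- by split=> //; apply/negP/notin_lam0 => //; apply: (@lam_dir InfLn f).
Qed.

Lemma has_dirP t f u v : (forall m, pt (f m)) -> valid t f -> pt u -> pt v ->
  u <> v -> v - u \in flat t f <-> has_dir t f u v.
Proof.
move=> pf vf pu pv uv.
have lvu : lam (v - u) = 0 by rewrite !lamE !ptP // subrr.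
have nvu : v - u != 0 by rewrite subr_eq0; apply/eqP => /esym.
have noline z : lam z = 1 -> v - u \in <[z]>%VS -> False.
  move=> lz /vlineP[c vE]; move: lvu; rewrite vE lamE lz mulr1 => c0.
  by move: nvu; rewrite vE c0 scale0r eqxx.
case: t vf => [_|lw|_|_|_]; rewrite /has_dir /=.
- by split=> //; apply: noline; rewrite ptP.
- by split=> //; apply: noline.
- split=> [/memv_addP[_ /vlineP[a ->] [_ /vlineP[b ->] e]]|[c ->]].
    have ab : a = - b.
      apply/eqP; rewrite -addr_eq0; apply/eqP; move: lvu.
      by rewrite e !lamE !ptP // !mulr1.
    by exists b; rewrite e ab; by_coordinates; ring.
  by rewrite scalerBr addrC -scaleNr memv_add ?memvZ ?memv_line.
- split=> [/vlineP[c e]|[c ->]]; first by exists c.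
  by rewrite memvZ ?memv_line.
split=> [/memv_addP[_ /vlineP[a ->] [_ /vlineP[b ->] e]]|[a [b ->]]].
  by exists a, b.
by rewrite memv_add ?memvZ ?memv_line.
Qed.

Lemma includedP s t e f : (forall m, pt (e m)) -> (forall m, pt (f m)) ->
  valid s e -> valid t f -> (flat s e <= flat t f)%VS <-> included s t e f.
Proof.
move=> pe pf ve vf.
case: s ve => [_|lw|ve|ve|[ve ne]]; rewrite /included /= ?subv_add -?memvE.
- exact: has_ptP.
- exact: has_wP.
- by rewrite -!has_ptP //; split=> [/andP|] // [-> ->].
- exact: has_dirP.
have n02 : e fst3 <> e trd3.
  by move=> e02; apply: ne; rewrite -e02; apply: online_l.
by rewrite -!has_dirP //; split=> [/andP|] // [-> ->].
Qed.

Lemma dim_flat t e : (forall m, pt (e m)) -> valid t e ->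
  \dim (flat t e) = (line_kind t).+1.
Proof.
move=> pe.
have n0 v : lam v = 1 -> v != 0.
  by move=> lv; apply/eqP => v0; move/eqP: lv; rewrite v0 lam0 eq_sym oner_eq0.
have nB u v : u <> v -> v - u != 0.
  by move=> uv; rewrite subr_eq0; apply/eqP => /esym.
case: t => [_|lw|ne|ne|[ne nl]]; rewrite /= ?dim_vline.
- by rewrite n0 // ptP.
- by rewrite n0.
- rewrite dim_add_line ?n0 ?ptP //; apply/negP => /line1P.
  by rewrite !ptP // => /(_ erefl erefl)/esym.
- by rewrite nB.
rewrite dim_add_line ?nB //; apply/negP => /vlineP[c cE]; apply: nl; exists c.
by rewrite -cE addrC subrK.
Qed.

Lemma definable_valid X (t : kind) (k : 'I_3 -> X) :
  definable (fun e : X -> V => valid t (fun m => e (k m))).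
Proof.
case: t => /=; rewrite ?/valid.
- exact: definable_const.
- exact: definable_const.
- by definable.
- by definable.
by definable; exact: definable_online.
Qed.

Lemma definable_included X (s t : kind) (k l : 'I_3 -> X) :
  definable (fun e : X -> V => included s t (fun m => e (k m)) (fun m => e (l m))).
Proof.
have dpt i : definable (fun e : X -> V => has_pt t (fun m => e (l m)) (e i)).
  case: t; rewrite /has_pt; first [exact: definable_const | by definable |
    exact: definable_online].
have ddir i j : definable (fun e : X -> V => has_dir t (fun m => e (l m)) (e i) (e j)).
  case: t {dpt}; rewrite /has_dir; first [exact: definable_const |
    exact: definable_parallel | exact: definable_parallel_plane].
case: s => /=.
- exact: dpt.
- case: t {dpt ddir} => /=; first [exact: definable_const |
    exact: definable_w_online].
- by apply: definable_and.
- exact: ddir.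
by apply: definable_and.
Qed.

Lemma pt_dim U : Pt U -> \dim U = 1%N.
Proof. by case/PtE => u pu ->; apply: (@dim_flat AffPt (fun _ => u)). Qed.

Lemma ln_dim U : Ln U -> \dim U = 2%N.
Proof.
case/LnE => u [v [pu pv uv ->]].
apply: (@dim_flat AffLn (triple u v v)); first exact: forall3.
by move=> e; apply: uv; rewrite [u]e eta_alt.
Qed.

(** A relation with an element of B1 reduces to relations between points: an
    element that is a line is replaced by two of its points. *)
Lemma definable_element (R : {vspace V} -> ('I_3 -> V) -> Prop) :
  definable (fun e : option 'I_3 -> V => R <[e None]>%VS (fun m => e (Some m))) ->
  definable (fun e : option (option 'I_3) -> V => e None <> e (Some None) ->
    R (<[e None]> + <[e (Some None)]>)%VS (fun m => e (Some (Some m)))) ->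
  exists phi : formula pl_language (option 'I_3), forall (a : 'I_3 -> {vspace V}) U,
    (forall m, Pt (a m)) -> dom M U ->
    (sat M phi (extend U a) <-> R U (fun m => rep (a m))).
Proof.
move=> [phi1 h1] [phi2 h2].
(* Two quantifiers bind the points [None] and [Some None] of the line
   [Some (Some None)]; the formula [phi2] speaks of the points but not
   of the line, hence the renaming. *)
pose g (x : option (option 'I_3)) : option (option (option 'I_3)) :=
  match x with
  | None => None
  | Some None => Some None
  | Some (Some m) => Some (Some (Some m))
  end.
pose l : option (option (option 'I_3)) := Some (Some None).
exists (FOr (FAnd (is_pt None) phi1)
  (FEx (FEx (FAnd (on_line None l) (FAnd (on_line (Some None) l)
    (FAnd (FNot (FEq None (Some None))) (rename g phi2))))))).
move=> a U pa domU.
have ptU : Pt U -> sat M phi1 (extend U a) <-> R U (fun m => rep (a m)).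
  by move=> pU; rewrite h1 /= ?repK // => -[].
have lnU U1 U2 : Pt U1 -> Pt U2 -> Ln U -> (U1 <= U)%VS -> (U2 <= U)%VS ->
    U1 <> U2 ->
    sat M (rename g phi2) (extend U2 (extend U1 (extend U a))) <->
    R U (fun m => rep (a m)).
  move=> p1 p2 lU s1 s2 n12; rewrite sat_rename h2; last by move=> [[]|].
  have n21 : rep U2 <> rep U1 by move=> e; apply: n12; rewrite -(repK p1) -e repK.
  rewrite /= !repK // (_ : (U2 + U1)%VS = U); first by split=> // h; apply: h.
  apply/eqP; rewrite eqEdim subv_add s1 s2 /= ln_dim //.
  rewrite -(repK p1) -(repK p2).
  rewrite (@dim_flat AffLn (triple (rep U2) (rep U1) (rep U1))) //.
  by apply: forall3; apply: rep_pt.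
split.
  case=> [[pU /(ptU pU)] //|[U1 _ [U2 _ [[p2 pU s2] [[p1 _ s1] [n12 h]]]]]].
  have n12' : U1 <> U2 by move=> e; apply: n12 => /=; rewrite e.
  exact: (lnU U1 U2 p1 p2 pU s1 s2 n12').1 h.
move=> RU; case: domU => [pU|lU]; first by left; split=> //; apply/ptU.
right; have [u [v [pu pv uv UE]]] := (LnE U).1 lU.
have p1 := Pt_line pu; have p2 := Pt_line pv.
have s1 : (<[u]> <= U)%VS by rewrite UE addvSl.
have s2 : (<[v]> <= U)%VS by rewrite UE addvSr.
have n12 : <[u]>%VS <> <[v]>%VS.
  move=> e; apply: uv; have : rep <[u]>%VS = rep <[v]>%VS by rewrite e.
  by rewrite !rep_line ?ptP // => ->; apply: eta_alt.
exists <[u]>%VS; first by left.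
exists <[v]>%VS; first by left.
by split=> //; split=> //; split; [move=> /= e; apply: n12 | apply/(lnU _ _ p1 p2)].
Qed.

(** Every clause of definability compares represented subspaces with each other
    or with an element of B1, so it comes down to inclusions; the kind alone
    tells points from lines, by dimension. *)
Theorem definable_in_of_kinds (Q : pred kind) (PN LN : {vspace V} -> Prop) :
  (forall (b : bool) U, (if b then LN U else PN U) <-> exists t (e : 'I_3 -> V),
    [/\ Q t, line_kind t = b, valid t e, forall m, pt (e m) & U = flat t e]) ->
  definable_in (pl_structure PN LN) M.
Proof.
move=> NE.
have [phi phiP] : exists phi : kind -> formula pl_language 'I_3,
    forall t (a : 'I_3 -> {vspace V}),
    (forall m, Pt (a m)) ->
    sat M (phi t) a <-> Q t /\ valid t (fun m => rep (a m)).
  apply: (@fin_all_exists kind (fun=> formula pl_language 'I_3)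
    (fun t psi => forall a : 'I_3 -> {vspace V}, (forall m, Pt (a m)) ->
      sat M psi a <-> Q t /\ valid t (fun m => rep (a m)))) => t.
  exact: definable_and (definable_const _ (Q t)) (definable_valid t id).
pose delta t := FAnd (is_pt fst3) (FAnd (is_pt snd3) (FAnd (is_pt trd3) (phi t))).
pose f t (a : 'I_3 -> {vspace V}) := flat t (fun m => rep (a m)).
have deltaP t (a : 'I_3 -> {vspace V}) : in_def M (delta t) a <->
    [/\ forall m, Pt (a m), Q t & valid t (fun m => rep (a m))].
  split=> [[_ [p0 [p1 [p2 h]]]]|[pa Qt vt]].
    have pa : forall m, Pt (a m) by apply: forall3.
    by move/(phiP _ _ pa): h => [].
  by split=> [m|]; [left | do 3!split=> //; apply/phiP].
have rpt (a : 'I_3 -> {vspace V}) : (forall m, Pt (a m)) ->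
    forall m, pt (rep (a m)) by move=> pa m; apply: rep_pt.
have inc s t (a b : 'I_3 -> {vspace V}) : in_def M (delta s) a -> in_def M (delta t) b ->
    (f s a <= f t b)%VS <->
    included s t (fun m => rep (a m)) (fun m => rep (b m)).
  by move=> /deltaP[pa _ va] /deltaP[pb _ vb]; apply: includedP => //; apply: rpt.
have fN t (a : 'I_3 -> {vspace V}) : in_def M (delta t) a ->
    (LN (f t a) <-> line_kind t) /\ (PN (f t a) <-> ~~ line_kind t).
  move=> /deltaP[pa Qt vt].
  have inN : if line_kind t then LN (f t a) else PN (f t a).
    apply/NE; exists t, (fun m => rep (a m)); split=> //; exact: rpt.
  have nN (b : bool) : (if b then LN (f t a) else PN (f t a)) -> line_kind t = b.
    move/NE=> [s [e [Qs <- vs pe fE]]].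
    have := dim_flat pe vs; rewrite -fE dim_flat //; last exact: rpt.
    by case: (line_kind t) (line_kind s) => -[].
  split; split=> [h|h].
  - exact: (nN true).
  - by move: inN; rewrite h.
  - by rewrite (nN false).
  - by move: inN; rewrite (negPf h).
exists kind, (fun _ => 3), delta, f; split.
- split=> [t a /fN[lnt ptt]|U].
    by case e: (line_kind t); [right; apply/lnt | left; apply/ptt; rewrite e].
  suff N (b : bool) : (if b then LN U else PN U) -> exists t (a : 'I_3 -> {vspace V}),
      in_def M (delta t) a /\ f t a = U.
    by case=> [/(N false)|/(N true)].
  move=> /NE[t [e [Qt _ vt pe ->]]].
  have eE : (fun m => rep <[e m]>%VS) = e.
    by apply: functional_extensionality => m; rewrite rep_line // ptP.
  exists t, (fun m => <[e m]>%VS); rewrite /f eE; split=> //.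
  by apply/deltaP; rewrite eE; split=> // m; apply: Pt_line.
- move=> s t.
  have [psi psiP] := definable_and
    (@definable_included ('I_3 + 'I_3) s t inl inr)
    (@definable_included ('I_3 + 'I_3) t s inr inl).
  exists psi => a b da db.
  rewrite psiP /=; last by move: da db => /deltaP[pa _ _] /deltaP[pb _ _] [].
  rewrite -(inc s t) // -(inc t s) //; split=> [[st ts]|->] //.
  by apply/eqP; rewrite eqEsubv st ts.
- case=> t /=.
  + have [psi psiP] := definable_const {i : 'I_1 & 'I_3} (~~ line_kind (t ord0)).
    exists psi => a da; rewrite psiP; last first.
      by move=> [i m] /=; case/deltaP: (da i).
    by apply: iff_sym; apply: (fN _ _ (da _)).2.
  + have [psi psiP] := definable_const {i : 'I_1 & 'I_3} (line_kind (t ord0)).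
    exists psi => a da; rewrite psiP; last first.
      by move=> [i m] /=; case/deltaP: (da i).
    by apply: iff_sym; apply: (fN _ _ (da _)).1.
  pose k i m : {i : 'I_2 & 'I_3} := existT _ i m.
  have [psi psiP] := definable_and3
    (definable_const {i : 'I_2 & 'I_3} (~~ line_kind (t ord0)))
    (definable_const {i : 'I_2 & 'I_3} (line_kind (t ord_max)))
    (@definable_included _ (t ord0) (t ord_max) (k ord0) (k ord_max)).
  exists psi => a da; rewrite psiP; last first.
    by move=> [i m] /=; case/deltaP: (da i).
  have [_ pt0] := fN _ _ (da ord0); have [ln1 _] := fN _ _ (da ord_max).
  have le01 := inc _ _ _ _ (da ord0) (da ord_max).
  by split=> [[/pt0 p0 /ln1 l1 /le01 h]|[/pt0 p0 /ln1 l1 /le01 h]].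
- move=> t.
  have [||psi psiP] := @definable_element (fun U e => valid t e ->
    (forall m, pt (e m)) -> (flat t e <= U)%VS).
  + apply: definable_ext; last first.
      exact: definable_imp (@definable_valid (option 'I_3) t Some)
       (@definable_included (option 'I_3) t AffPt Some (fun=> None)).
    move=> e pe /=; split=> [h vt _|h vt].
      by apply/(@includedP t AffPt _ (fun=> e None)) => //; apply: h.
    by apply/includedP => //; apply: h.
  + apply: definable_ext; last first.
      exact: definable_imp (definable_not (definable_eq None (Some None)))
       (definable_imp (@definable_valid (option (option 'I_3)) t (fun m => Some (Some m)))
       (@definable_included (option (option 'I_3)) t AffLn (fun m => Some (Some m))
        (triple None (Some None) None))).
    move=> e pe /=; split=> h ne vt.
      by move=> _; apply/(@includedP t AffLn _ (fun m => e (triple None (Some None) None m)));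
        rewrite ?/valid //; apply: h.
    by apply/includedP => //; apply: h.
  exists psi => a U /deltaP[pa _ vt] domU; rewrite psiP //.
  by split=> [h|h _ _] //; apply: h => //; apply: rpt.
move=> t.
have [||psi psiP] := @definable_element (fun U e => valid t e ->
  (forall m, pt (e m)) -> (U <= flat t e)%VS).
+ apply: definable_ext; last first.
    exact: definable_imp (@definable_valid (option 'I_3) t Some)
     (@definable_included (option 'I_3) AffPt t (fun=> None) Some).
  move=> e pe /=; split=> [h vt _|h vt].
    by apply/(@includedP AffPt t (fun=> e None)) => //; apply: h.
  by apply/(@includedP AffPt t (fun=> e None)) => //; apply: h.
+ apply: definable_ext; last first.
    exact: definable_imp (definable_not (definable_eq None (Some None)))
     (definable_imp (@definable_valid (option (option 'I_3)) t (fun m => Some (Some m)))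
     (@definable_included (option (option 'I_3)) AffLn t
      (triple None (Some None) None) (fun m => Some (Some m)))).
  move=> e pe /=; split=> h ne vt.
    by move=> _; apply/(@includedP AffLn t (fun m => e (triple None (Some None) None m)));
      rewrite ?/valid //; apply: h.
  by apply/(@includedP AffLn t (fun m => e (triple None (Some None) None m)));
    rewrite ?/valid //; apply: h.
exists psi => a U /deltaP[pa _ vt] domU; rewrite psiP //.
by split=> [h|h _ _] //; apply: h => //; apply: rpt.
Qed.

End Geometry.

(** * The pseudo-polarity *)
Section PseudoPolarity.

Variables (F : fieldType) (V : vectType F).
Implicit Types (U : {vspace V}) (u v h : V).

Hypothesis F_char2 : 2%N \in [pchar F].
Hypothesis F_perfect : perfect_field F.
Hypothesis dimV : (2 <= \dim {:V})%N.
Variable xi : {symmetric V}.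
Hypothesis xi_nondeg : nondegenerate xi.

Lemma xiC u v : xi u v = xi v u.
Proof. by rewrite hermC expr0 mul1r. Qed.
Lemma xiDl u v h : xi (u + v) h = xi u h + xi v h.
Proof. exact: linearDl. Qed.
Lemma xiZl (a : F) u h : xi (a *: u) h = a * xi u h.
Proof. exact: linearZl_LR. Qed.
Lemma xiDr u v h : xi h (u + v) = xi h u + xi h v.
Proof. by rewrite !(xiC h) xiDl. Qed.
Lemma xiZr (a : F) u h : xi h (a *: u) = a * xi h u.
Proof. by rewrite !(xiC h) xiZl. Qed.

Lemma xi_rad u : (forall v, xi v u = 0) -> u = 0.
Proof.
move=> h; apply/eqP; rewrite -memv0 -(eqP xi_nondeg).
by apply/mem_orthovP => v _; rewrite xiC.
Qed.

Lemma xi_sum (I : finType) (c : I -> F) (e : I -> V) h :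
  xi (\sum_i c i *: e i) h = \sum_i c i * xi (e i) h.
Proof.
have xi0 : xi 0 h = 0 by rewrite -[0 in LHS](scale0r 0) xiZl mul0r.
rewrite (big_morph (fun u => xi u h) (fun u v => xiDl u v h) xi0).
by apply: eq_bigr => i _; rewrite xiZl.
Qed.

(** The Gram matrix of a basis is invertible, and the coordinates of the
    representing vector solve the linear system with that matrix. *)
Lemma represent (phi : V -> F) :
  (forall a u v, phi (a *: u + v) = a * phi u + phi v) ->
  exists w, forall u, phi u = xi u w.
Proof.
move=> phi_lin; pose e := vbasis {:V}.
pose G : 'M_(\dim {:V}) := \matrix_(i, j) xi e`_i e`_j.
have eE u : u = \sum_i coord e i u *: e`_i by apply: coord_vbasis; apply: memvf.
have Gu : G \in unitmx.
  rewrite -row_free_unit; apply: inj_row_free => r rG.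
  have r0 : \sum_i r 0 i *: e`_i = 0.
    apply: xi_rad => v; rewrite (eE v) xi_sum big1 // => j _.
    rewrite xiC xi_sum; have /rowP/(_ j) := rG; rewrite !mxE => rGj.
    by rewrite (eq_bigr (fun i => r 0 i * G i j)) ?rGj ?mulr0 // => i _; rewrite mxE.
  apply/rowP => j; rewrite mxE.
  by have /freeP/(_ _ r0 j) := basis_free (vbasisP {:V}).
pose c := (\row_j phi e`_j) *m invmx G.
exists (\sum_i c 0 i *: e`_i) => u.
have phiE (I : finType) (a : I -> F) (f : I -> V) :
    phi (\sum_i a i *: f i) = \sum_i a i * phi (f i).
  have phi0 : phi 0 = 0.
    have := phi_lin (-1) 0 0; rewrite scaler0 addr0 mulN1r addNr. by [].
  elim/big_rec2: _ => [//|i x y _ <-]; exact: phi_lin.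
rewrite {1}(eE u) phiE {2}(eE u) xi_sum; apply: eq_bigr => j _; congr (_ * _).
rewrite xiC xi_sum.
transitivity ((c *m G) 0 j); first by rewrite mulmxKV // mxE.
by rewrite mxE; apply: eq_bigr => i _; rewrite !mxE.
Qed.

(** In characteristic 2 the square of a sum is the sum of the squares, and the
    cross terms of xi (u + v) (u + v) cancel by symmetry, so the square root,
    which exists and is unique over a perfect field, is linear. *)
Lemma square_root : exists phi : V -> F,
  (forall a u v, phi (a *: u + v) = a * phi u + phi v) /\
  forall u, xi u u = phi u ^+ 2.
Proof.
have root (x : F) : exists y, y ^+ 2 == x.
  by have [y <-] := F_perfect F_char2 x; exists y.
pose phi u := xchoose (root (xi u u)).
have phiE u : xi u u = phi u ^+ 2 by apply/esym/eqP/(xchooseP (root _)).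
have sq_inj (x y : F) : x ^+ 2 = y ^+ 2 -> x = y.
  move=> xy; apply/eqP; rewrite -subr_eq0 -sqrf_eq0 sqrrB xy addrAC -mulr2n.
  by rewrite -[x * y *+ 2]mulr_natr -[_ ^+ 2 *+ 2]mulr_natr (pcharf0 F_char2) !mulr0 subrr.
exists phi; split=> // a u v; apply: sq_inj; rewrite -phiE.
rewrite !(xiDl, xiDr, xiZl, xiZr) (xiC v u) !phiE.
move: (phi u) (phi v) (xi u v) => x y z.
apply/eqP; rewrite -subr_eq0; apply/eqP.
have -> : a * (a * x ^+ 2) + a * z + (a * z + y ^+ 2) - (a * x + y) ^+ 2 =
  (a * z - a * x * y) * 2%:R by ring.
by rewrite (pcharf0 F_char2) mulr0.
Qed.

Hypothesis xi_nonalt : ~ (forall u : V, xi u u = 0).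
Hypothesis five_scalars :
  forall s : seq F, (size s <= 4)%N -> exists c, c \notin s.
Variable w : V.
Hypothesis xi_square : forall u, xi u u = xi u w ^+ 2.

Definition lam u : F := xi u w.
(** The correction makes [xi] alternating without changing it on H. *)
Definition eta u v : F := xi u v + lam u * lam v.

Lemma addFF (x : F) : x + x = 0. Proof. exact: addrr_pchar2. Qed.
Lemma oppF (x : F) : - x = x. Proof. exact: oppr_pchar2. Qed.

Lemma lam_linear a u v : lam (a *: u + v) = a * lam u + lam v.
Proof. by rewrite /lam xiDl xiZl. Qed.

Lemma eta_linear a u v h : eta (a *: u + v) h = a * eta u h + eta v h.
Proof. by rewrite /eta lam_linear xiDl xiZl; ring. Qed.

Lemma eta_anti u v : eta u v = - eta v u.
Proof. by rewrite oppF /eta xiC mulrC. Qed.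

Lemma eta_alt u : eta u u = 0.
Proof. by rewrite /eta xi_square -expr2 addFF. Qed.

Lemma eta_rad r : (forall v, eta v r = 0) -> r = lam r *: w.
Proof.
move=> h; apply/eqP; rewrite -subr_eq0; apply/eqP; apply: xi_rad => v.
rewrite -[- _]scaleN1r xiDr !xiZr mulN1r oppF -[RHS](h v) /eta mulrC.
by rewrite /lam [xi v w * _]mulrC mulrC.
Qed.

Lemma eta_w : lam w = 1 -> forall v, eta v w = 0.
Proof. by move=> lw v; rewrite /eta lw mulr1 addFF. Qed.

Local Notation pt := (pt lam w).

Let lamE := (lamD lam_linear, lamN lam_linear, lamZ lam_linear).

Lemma xi_diag_eq0 u : xi u u = 0 <-> lam u = 0.
Proof.
rewrite xi_square -/(lam u); split=> [/eqP|->]; last by rewrite expr0n.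
by rewrite sqrf_eq0 => /eqP.
Qed.

Lemma regular_line u : lam u <> 0 <-> u <> 0 /\ regular xi <[u]>.
Proof.
split=> [lu|[u0 reg] /xi_diag_eq0 uu].
  split=> [u0|]; first by apply: lu; rewrite u0 (lam0 lam_linear).
  apply/eqP; rewrite -subv0; apply/subvP => x; rewrite memv_cap memv0.
  case/andP=> /vlineP[c ->]; rewrite mem_orthov1 xiZl mulf_eq0.
  by case/orP=> [/eqP->|/eqP/xi_diag_eq0 //]; rewrite scale0r.
apply: u0; apply/eqP; rewrite -memv0 -reg memv_cap memv_line.
by rewrite mem_orthov1; apply/eqP.
Qed.

Lemma perp_line u v : perp xi <[u]> <[v]> <-> xi u v = 0.
Proof. by rewrite /perp -memvE mem_orthov1; split=> /eqP. Qed.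

Lemma selfconjugate_line u : selfconjugate xi <[u]> <-> u <> 0 /\ lam u = 0.
Proof.
rewrite /selfconjugate perp_line xi_diag_eq0 /is_point dim_vline.
by case: eqP => u0; split=> -[].
Qed.

Lemma lam_notH U : ~ contained_in_H xi U <-> exists2 u, u \in U & lam u <> 0.
Proof.
split=> [nH|[u uU lu] H].
  apply: NNPP => no; apply: nH => p /is_pointP[u u0 ->]; rewrite -memvE => uU.
  apply/selfconjugate_line; split; first exact/eqP.
  by apply: NNPP => lu; apply: no; exists u.
have u0 : u <> 0 by move=> u0; apply: lu; rewrite u0 (lam0 lam_linear).
have := H <[u]>%VS; rewrite -memvE /is_point dim_vline => /(_ _ uU).
by case: eqP => // _ /(_ erefl)/selfconjugate_line[].
Qed.

(** If <[v]>^perp = H, then xi u v vanishes on the kernel of [lam], hence is a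
    multiple of [lam], and [v] is a multiple of [w] by nondegeneracy. *)
Lemma pole_line v : is_pole_of_H xi <[v]> <-> v <> 0 /\ <[v]>%VS = <[w]>%VS.
Proof.
have [u0 lu0] : exists u, lam u <> 0.
  apply: NNPP => no; apply: xi_nonalt => u; apply/xi_diag_eq0.
  by apply: NNPP => lu; apply: no; exists u.
have w0 : w != 0.
  apply/eqP => w0; apply: lu0.
  by rewrite /lam w0 xiC -[0 in LHS](scale0r 0) xiZl mul0r.
split=> [[pv H]|[v0 ->]]; last first.
  split=> [|p /is_pointP[u u0' ->]]; first by rewrite /is_point dim_vline w0.
  by rewrite perp_line selfconjugate_line; split=> [|[]] //; split=> //; apply/eqP.
have v0 : v != 0 by move: pv; rewrite /is_point dim_vline; case: (v != 0).
split; first exact/eqP.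
have lamv u : lam u = 0 -> xi u v = 0.
  move=> lu; have [->|u_n0] := eqVneq u 0.
    by rewrite -[0 in LHS](scale0r 0) xiZl mul0r.
  apply/perp_line/H; first by rewrite /is_point dim_vline u_n0.
  by apply/selfconjugate_line; split=> //; apply/eqP.
have vE : v = (xi u0 v / lam u0) *: w.
  apply/eqP; rewrite -subr_eq0; apply/eqP; apply: xi_rad => u.
  rewrite -[- _]scaleN1r xiDr !xiZr -/(lam u).
  have := lamv (u - (lam u / lam u0) *: u0).
  rewrite !lamE divfK; last exact/eqP.
  rewrite subrr -[- _]scaleN1r xiDl !xiZl => /(_ erefl) <-.
  by field; apply/eqP.
apply/eqP; rewrite eqEdim -memvE vE memvZ ?memv_line //.
by rewrite -vE !dim_vline v0 w0.
Qed.

Lemma normal_form U : is_point U -> (exists2 u, u \in U & lam u <> 0) ->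
  exists2 u, lam u = 1 & U = <[u]>%VS.
Proof.
move=> /is_pointP[u u0 ->] [_ /vlineP[c ->] lcu].
have lu : lam u != 0.
  by apply/eqP => lu; apply: lcu; rewrite lamE lu mulr0.
exists ((lam u)^-1 *: u); first by rewrite lamE mulVf.
by rewrite lineZ // invr_eq0.
Qed.

Lemma dir_in U u : (2 <= \dim U)%N -> lam u = 1 -> u \in U ->
  exists h, [/\ h \in U, lam h = 0 & h != 0].
Proof.
move=> dU lu uU; have [v vU vu] := line_other u dU.
exists (v - lam v *: u); split.
- by rewrite memvB // memvZ.
- by rewrite !lamE lu mulr1 subrr.
by apply: contraNneq vu => /eqP; rewrite subr_eq0 => /eqP->; rewrite memvZ ?memv_line.
Qed.

Lemma pt_in U : (2 <= \dim U)%N -> (exists2 u, u \in U & lam u <> 0) ->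
  exists2 u, pt u & u \in U.
Proof.
move=> dU [v vU /eqP lv]; pose u := (lam v)^-1 *: v.
have lu : lam u = 1 by rewrite lamE mulVf.
have uU : u \in U by rewrite memvZ.
have [uw|uw] := eqVneq u w; last by exists u => //; rewrite /pt lu eqxx.
have [h [hU lh h0]] := dir_in dU lu uU.
exists (u + h); last by rewrite memvD.
rewrite /pt lamE lu lh addr0 eqxx /=; apply: contraNneq h0 => uhw.
by apply/eqP/(addrI u); rewrite uhw addr0 uw.
Qed.

Lemma exists_pt : exists o, pt o.
Proof.
have [] := @pt_in fullv dimV; last by move=> o; exists o.
apply: NNPP => no; apply: xi_nonalt => u; apply/xi_diag_eq0.
by apply: NNPP => lu; apply: no; exists u; rewrite ?memvf.
Qed.

Lemma dim_pts u v : lam u = 1 -> lam v = 1 -> u <> v ->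
  \dim (<[u]> + <[v]>) = 2%N.
Proof.
move=> lu lv uv; rewrite dim_add_line //.
  by apply/eqP => u0; move/eqP: lu; rewrite u0 (lam0 lam_linear) eq_sym oner_eq0.
by apply/negP => /(line1P lam_linear lu lv)/esym.
Qed.

Lemma affine_lineP U : is_line U -> ~ contained_in_H xi U ->
  exists u v, [/\ pt u, pt v, u <> v & U = (<[u]> + <[v]>)%VS].
Proof.
move=> dU /lam_notH nH; have dU2 : (2 <= \dim U)%N by rewrite dU.
have [u pu uU] := pt_in dU2 nH.
have [h [hU lh h0]] := dir_in dU2 (ptP pu) uU.
have [c c0 pv] := shift_pt five_scalars lam_linear pu lh.
have uv : u <> u + c *: h.
  move/eqP; rewrite eq_sym -subr_eq0 addrC addKr scaler_eq0 (negPf c0).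
  exact/negP.
exists u, (u + c *: h); split=> //; apply/esym/eqP.
rewrite eqEdim subv_add -!memvE uU memvD ?memvZ //=.
by rewrite dU (dim_pts (ptP pu) (ptP pv) uv).
Qed.

(** If [w] and a normalised [u] span the same point, then they are equal:
    lam w is nonzero and lam w = xi w w = lam w ^ 2, so lam w = 1. *)
Lemma B1_pointP U :
  [/\ is_point U, regular xi U & ~ is_pole_of_H xi U] <->
  exists2 u, pt u & U = <[u]>%VS.
Proof.
split=> [[pU]|[u pu ->]].
  have [v v0 UE] := is_pointP pU; rewrite UE => reg npole.
  have lv : lam v <> 0 by apply/regular_line; split=> //; apply/eqP.
  have [|u lu vu] := normal_form pU; first by exists v => //; rewrite UE memv_line.
  exists u; last by rewrite -vu.
  rewrite /pt lu eqxx /=; apply/eqP => uw; apply: npole; apply/pole_line.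
  by split; [apply/eqP | rewrite -UE vu uw].
have lu : lam u <> 0 by rewrite (ptP pu); apply/eqP/oner_neq0.
have [u0 reg] := (regular_line u).1 lu.
split=> //; first by rewrite /is_point dim_vline; case: eqP.
move=> /pole_line[_ uw]; apply: (pt_neq pu).
have /vlineP[c uE] : u \in <[w]>%VS by rewrite -uw memv_line.
have lc : c * lam w = 1 by rewrite -(ptP pu) uE lamE.
have lw : lam w = 1.
  have /eqP := xi_square w; rewrite -/(lam w) expr2 -subr_eq0.
  rewrite -{1}[lam w]mulr1 -mulrBr mulf_eq0 subr_eq0 => /orP[/eqP lw0|/eqP //].
  by move/eqP: lc; rewrite lw0 mulr0 eq_sym oner_eq0.
by rewrite uE -[c]mulr1 -lw lc scale1r.
Qed.

(** For normalised [u] and [v], xi u u = xi v v = 1 and eta u v = xi u v + 1.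
    On the line uv only the multiples of v - u are selfconjugate, and
    xi (v - u) u = eta u v, so the line is regular iff eta u v is nonzero. *)
Lemma B1_lineP U :
  [/\ is_line U, regular xi U & ~ contained_in_H xi U] <->
  exists u v, [/\ pt u, pt v, eta u v <> 0 & U = (<[u]> + <[v]>)%VS].
Proof.
split=> [[lU reg nH]|[u [v [pu pv uv ->]]]].
  have [u [v [pu pv uv UE]]] := affine_lineP lU nH.
  exists u, v; split=> // uv0; apply: uv; apply/esym/eqP; rewrite -subr_eq0.
  have uuE : xi u u = 1 by rewrite xi_square -/(lam u) (ptP pu) expr1n.
  have vvE : xi v v = 1 by rewrite xi_square -/(lam v) (ptP pv) expr1n.
  have uvE : xi u v = 1.
    move/eqP: uv0; rewrite /eta (ptP pu) (ptP pv) mulr1.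
    by rewrite addr_eq0 oppF => /eqP.
  rewrite -memv0 -reg memv_cap UE memvB ?mem_span2r ?mem_span2l //=.
  apply/mem_orthovP => _ /memv_addP[_ /vlineP[a ->] [_ /vlineP[b ->] ->]].
  rewrite -[- u]scaleN1r !(xiDl, xiZl, xiDr, xiZr) uuE vvE uvE xiC uvE.
  by ring.
have uv' : u <> v by move=> e; apply: uv; rewrite e eta_alt.
have uuE : xi u u = 1 by rewrite xi_square -/(lam u) (ptP pu) expr1n.
split; first exact: dim_pts (ptP pu) (ptP pv) uv'.
  apply/eqP; rewrite -subv0; apply/subvP => x; rewrite memv_cap memv0.
  case/andP=> /memv_addP[_ /vlineP[a ->] [_ /vlineP[b ->] xE]] /mem_orthovP ox.
  have xx : xi x x = 0.
    by apply: ox; rewrite xE memvD ?memvZ ?mem_span2l ?mem_span2r.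
  have xu : xi x u = 0 by apply: ox; apply: mem_span2l.
  have ab : b = - a.
    move/xi_diag_eq0: xx; rewrite xE !lamE (ptP pu) (ptP pv) !mulr1 => /eqP.
    by rewrite addrC addr_eq0 => /eqP.
  have a0 : a * eta u v = 0.
    rewrite -[RHS]xu xE xiDl !xiZl uuE ab /eta (ptP pu) (ptP pv) [xi v u]xiC.
    by rewrite oppF; ring.
  move/eqP: a0; rewrite mulf_eq0 => /orP[/eqP a0|/eqP //].
  by rewrite xE ab a0 oppr0 !scale0r addr0.
by apply/lam_notH; exists u; [apply: mem_span2l | rewrite (ptP pu); apply/eqP/oner_neq0].
Qed.

Lemma B1_definable (Q : pred kind) (PN LN : {vspace V} -> Prop) :
  (forall (b : bool) U, (if b then LN U else PN U) <->
    exists t (e : 'I_3 -> V), [/\ Q t, line_kind t = b, valid lam w t e,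
      forall m, pt (e m) & U = flat w t e]) ->
  definable_in (pl_structure PN LN) (structure_B1 xi).
Proof.
apply: (definable_in_of_kinds five_scalars lam_linear eta_linear eta_anti
  eta_alt eta_rad eta_w B1_pointP B1_lineP).
Qed.

Lemma affine_definable : definable_in (affine_space xi) (structure_B1 xi).
Proof.
have [o po] := exists_pt.
apply: (@B1_definable (fun t => if t is (InfPt | InfLn) then false else true)).
case=> U; split.
- case=> lU /(affine_lineP lU)[u [v [pu pv uv ->]]].
  by exists AffLn, (triple u v v); split=> //; apply: forall3.
- move=> [[] [e [// _ _ ne pe ->]]]; split.
    by rewrite /is_line (dim_pts (ptP (pe _)) (ptP (pe _)) ne).
  apply/lam_notH; exists (e fst3); first exact: mem_span2l.
  by rewrite (ptP (pe _)); apply/eqP/oner_neq0.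
- case=> pU; have [v v0 UE] := is_pointP pU; rewrite UE => reg.
  have lv : lam v <> 0 by apply/regular_line; split=> //; apply/eqP.
  have [|u lu vu] := normal_form pU; first by exists v => //; rewrite UE memv_line.
  rewrite -UE vu; have [uw|uw] := eqVneq u w.
    by exists Pole, (fun=> o); split=> //; rewrite -?uw.
  exists AffPt, (fun=> u); split=> // _; by rewrite /pt lu eqxx.
have aff u : lam u = 1 -> is_point <[u]>%VS /\ regular xi <[u]>.
  move=> lu; have [|u0 reg] := (regular_line u).1; first by rewrite lu; apply/eqP/oner_neq0.
  by split=> //; rewrite /is_point dim_vline; case: eqP.
by move=> [[] [e [// _ _ ve pe ->]]]; apply: aff => //; apply: ptP.
Qed.

Lemma projective_definable : definable_in (projective_space V) (structure_B1 xi).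
Proof.
have [o po] := exists_pt.
apply: (@B1_definable predT).
case=> U; split; last first.
- by move=> [t [e [_ lt ve pe ->]]]; rewrite /is_point (dim_flat lam_linear pe ve) lt.
- move=> pU; have [v v0 UE] := is_pointP pU.
  have [lv|/eqP lv] := eqVneq (lam v) 0.
    have [c c0 pc] := shift_pt five_scalars lam_linear po lv.
    exists InfPt, (triple o (o + c *: v) o); split=> //.
    + move/eqP; rewrite [X in X == _]/= eq_sym -subr_eq0 addrC addKr scaler_eq0.
      by rewrite (negPf c0) (negPf v0).
    + exact: forall3.
    by rewrite UE /= /triple /= addrC addKr lineZ.
  have [|u lu vu] := normal_form pU; first by exists v => //; rewrite UE memv_line.
  rewrite vu; have [uw|uw] := eqVneq u w.
    by exists Pole, (fun=> o); split=> //; rewrite -?uw.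
  exists AffPt, (fun=> u); split=> // _; by rewrite /pt lu eqxx.
- by move=> [t [e [_ lt ve pe ->]]]; rewrite /is_line (dim_flat lam_linear pe ve) lt.
move=> lU; have [H|nH] := classic (contained_in_H xi U); last first.
  have [u [v [pu pv uv ->]]] := affine_lineP lU nH.
  by exists AffLn, (triple u v v); split=> //; apply: forall3.
have lam0 u : u \in U -> lam u = 0.
  by move=> uU; apply: NNPP => lu; case: (lam_notH U).2 => //; exists u.
have dU : (2 <= \dim U)%N by rewrite lU.
have [h hU h1] := line_other 0 dU.
have h0 : h != 0 by apply: contraNneq h1 => ->; apply: mem0v.
have [k kU hk] := line_other h dU.
have k0 : k != 0 by apply: contraNneq hk => ->; apply: mem0v.
have [a a0 pa] := shift_pt five_scalars lam_linear po (lam0 _ hU).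
have [b b0 pb] := shift_pt five_scalars lam_linear po (lam0 _ kU).
exists InfLn, (triple o (o + a *: h) (o + b *: k)); split=> //.
- split.
    move/eqP; rewrite [X in X == _]/= eq_sym -subr_eq0 addrC addKr scaler_eq0.
    by rewrite (negPf a0) (negPf h0).
  move=> [c]; rewrite /triple /= => /addrI; rewrite [o + _]addrC addrK => kE.
  by case/negP: hk; rewrite -(scalerK b0 k) kE !memvZ ?memv_line.
- exact: forall3.
rewrite /= /triple /= ![o + _]addrC !addrK (is_lineE lU hU kU h0 hk).
by rewrite !lineZ.
Qed.

End PseudoPolarity.

Theorem theorem3p13
    (F : fieldType) (F_char2 : 2%N \in [pchar F]) (F_perfect : perfect_field F)
    (V : vectType F) (n : nat) (dimV : \dim {:V} = n) (n_ge2 : (2 <= n)%N)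
    (lines6 : lines_have_at_least V 6)
    (xi : {symmetric V}) (xi_nondeg : nondegenerate xi)
    (xi_nonalt : ~ (forall u : V, xi u u = 0)) :
  definable_in (affine_space xi) (structure_B1 xi) /\
  definable_in (projective_space V) (structure_B1 xi).
Proof.
rewrite -dimV in n_ge2.
have five := five_scalars_of_points n_ge2 lines6.
have [phi [phi_lin phi_sq]] := square_root F_char2 F_perfect xi.
have [w phiE] := represent xi_nondeg phi_lin.
have xi_sq u : xi u u = xi u w ^+ 2 by rewrite phi_sq phiE.
split.
  exact: (affine_definable F_char2 n_ge2 xi_nondeg xi_nonalt five xi_sq).
exact: (projective_definable F_char2 n_ge2 xi_nondeg xi_nonalt five xi_sq).
Qed.
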